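(* Let $G$ be an open quasi-Polish groupoid, $p : X \to G_0$ a standard Borel $G$-space with action $\alpha$, and $\mathcal{S} \subseteq \mathcal{B}(X)$ a compatible $\sigma$-topology such that $p^{-1}(\mathcal{O}(G_0)) \subseteq \mathcal{S}$ and $\mathcal{O}(G) \circledast \mathcal{S} \subseteq \mathcal{S}$. For any Borel $A \subseteq X$ the following are equivalent: (i) $A$ is open in some quasi-Polish topology $\mathcal{O}(X) \subseteq \mathcal{S}$ making $p$ and the action continuous; (ii) $A \in \mathcal{O}(G) \circledast \mathcal{S}$, i.e., $A = \bigcup_i (U_i * A_i)$ for countably many $U_i \in \mathcal{O}(G)$, $A_i \in \mathcal{S}$; (iii) $\alpha^{-1}(A) \in \mathcal{O}(G) \otimes_{G_0} \mathcal{S}$; (iv) $\alpha^{-1}(A) \in \mathcal{O}(G) \otimes_{G_0} (\mathcal{O}(G) \circledast \mathcal{S})$. In particular every $G$-invariant $A \in \mathcal{S}$ satisfies these conditions. Moreover, countably many Borel sets satisfying these conditions can be made simultaneously open in a single topology as in (i).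
   Context: A quasi-Polish groupoid is a topological groupoid (object space $G_0$, morphism space $G$, continuous source $\sigma$, target $\tau$, multiplication, identity, inverse) with $G$ quasi-Polish (de Brecht); it is open if $\sigma$ is an open map. A standard Borel $G$-space is a standard Borel space $X$ with a Borel map $p : X \to G_0$ and a Borel action $\alpha : G \times_{G_0} X \to X$, $G \times_{G_0} X := \{(g,a) \mid \sigma(g) = p(a)\}$, $\alpha(g,a) = ga$, $p(ga) = \tau(g)$, satisfying associativity and identity laws. A $\sigma$-topology is a family closed under finite intersections and countable unions; $\mathcal{S} \subseteq \mathcal{B}(X)$ is compatible if every countable subset of $\mathcal{S}$ is contained in a quasi-Polish topology contained in $\mathcal{S}$. $U \times_{G_0} A := \{(g,a) \in U \times A \mid \sigma(g) = p(a)\}$, and $\mathcal{T} \otimes_{G_0} \mathcal{S}$ denotes countable unions of such sets with $U \in \mathcal{T}$, $A \in \mathcal{S}$. Vaught transform: $U * A := \{a \in X \mid \exists^* g \in \tau^{-1}(p(a))\,(g \in U \text{ and } a \in gA)\}$ (nonmeager in the subspace $\tau^{-1}(p(a))$); $\mathcal{O}(G) \circledast \mathcal{S}$ = countable unions of $U_i * A_i$ with $U_i$ open, $A_i \in \mathcal{S}$. *)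

(* Defs.v *)
From HB Require Import structures.
From mathcomp Require Import all_boot all_order all_algebra.
From mathcomp Require Import boolp classical_sets functions cardinality.
From mathcomp Require Import reals topology measure Rstruct.

Set Implicit Arguments.
Unset Strict Implicit.
Unset Printing Implicit Defensive.

Import Order.TTheory GRing.Theory Num.Theory.
Local Open Scope classical_set_scope.
Local Open Scope ring_scope.

Local Notation R := Rdefinitions.R.

(* Several topologies on one and the same carrier are compared below, and the
   carrier may be empty.  A topology (resp. a Borel structure) on X is therefore
   given by its family of open (resp. Borel) sets, of type set (set X).  A
   topologicalType T is passed to these notions as its family @open T. *)

Section QuasiPolish.
Variable T : Type.
Implicit Types (d : T -> T -> R) (O : set (set T)).

Record quasi_metric d : Prop := QuasiMetric {
  quasi_metric_ge0 : forall x y, 0 <= d x y ;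
  quasi_metric_eq0 : forall x y, (d x y = 0 /\ d y x = 0) <-> x = y ;
  quasi_metric_triangle : forall x y z, d x z <= d x y + d y z }.

Definition induces_topology d O : Prop :=
  forall U, O U <->
    (forall x, U x -> exists2 e : R, 0 < e & [set y | d x y < e] `<=` U).

Definition quasi_cauchy d (u : nat -> T) : Prop :=
  forall e : R, 0 < e -> exists N : nat,
    forall m n : nat, (N <= m)%N -> (m <= n)%N -> d (u m) (u n) < e.

(* Smyth completeness: the limit is taken in the topology of the symmetrized
   metric max (d x y) (d y x). *)
Definition quasi_complete d : Prop :=
  forall u : nat -> T, quasi_cauchy d u -> exists x : T,
    forall e : R, 0 < e -> exists N : nat,
      forall n : nat, (N <= n)%N -> Num.max (d x (u n)) (d (u n) x) < e.

Definition countably_based O : Prop :=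
  exists B : set (set T), [/\ countable B, B `<=` O &
    forall U x, O U -> U x -> exists2 V, B V & V x /\ V `<=` U].

(* De Brecht: countably based and completely quasi-metrizable. *)
Definition quasi_polish O : Prop :=
  countably_based O /\
  exists d, [/\ quasi_metric d, quasi_complete d & induces_topology d O].

Definition polish O : Prop :=
  countably_based O /\
  exists d, [/\ quasi_metric d, (forall x y, d x y = d y x),
                quasi_complete d & induces_topology d O].

Definition standard_borel (BX : set (set T)) : Prop :=
  exists2 O, polish O & BX = <<s O >>.

Definition countable_unions (F : set (set T)) : set (set T) :=
  [set A | exists C : set (set T),
    [/\ countable C, C `<=` F & A = \bigcup_(B in C) B]].

Record sigma_topology (S : set (set T)) : Prop := SigmaTopology {
  sigma_topologyT : S setT ;
  sigma_topologyI : forall A B, S A -> S B -> S (A `&` B) ;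
  sigma_topology_bigcup : countable_unions S `<=` S }.

Definition compatible (S : set (set T)) : Prop :=
  forall C : set (set T), countable C -> C `<=` S ->
    exists O, [/\ quasi_polish O, C `<=` O & O `<=` S].

End QuasiPolish.

Section Category.
Variable T : topologicalType.

Definition nowhere_dense (E : set T) : Prop := interior (closure E) = set0.

Definition meager (E : set T) : Prop :=
  exists2 F : nat -> set T,
    (forall n, nowhere_dense (F n)) & E = \bigcup_n F n.

End Category.

(* [set_type Y] carries the subspace topology. *)
Definition nonmeager_in (T : topologicalType) (Y E : set T) : Prop :=
  ~ @meager (set_type Y) [set y | E (set_val y)].

(* The product [gmul g h] is meaningful only when [gsrc g = gtgt h]; its values
   at other pairs are unconstrained. *)
Record topGroupoid (G0 G : topologicalType) := TopGroupoid {
  gsrc : G -> G0 ;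
  gtgt : G -> G0 ;
  gmul : G -> G -> G ;
  gid : G0 -> G ;
  ginv : G -> G ;
  gsrc_continuous : continuous gsrc ;
  gtgt_continuous : continuous gtgt ;
  gmul_continuous :
    {within [set gh : G * G | gsrc gh.1 = gtgt gh.2],
      continuous (fun gh : G * G => gmul gh.1 gh.2)} ;
  gid_continuous : continuous gid ;
  ginv_continuous : continuous ginv ;
  gsrc_mul : forall g h, gsrc g = gtgt h -> gsrc (gmul g h) = gsrc h ;
  gtgt_mul : forall g h, gsrc g = gtgt h -> gtgt (gmul g h) = gtgt g ;
  gmulA : forall g h k, gsrc g = gtgt h -> gsrc h = gtgt k ->
    gmul g (gmul h k) = gmul (gmul g h) k ;
  gsrc_id : forall x, gsrc (gid x) = x ;
  gtgt_id : forall x, gtgt (gid x) = x ;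
  gmul_idl : forall g, gmul (gid (gtgt g)) g = g ;
  gmul_idr : forall g, gmul g (gid (gsrc g)) = g ;
  gsrc_inv : forall g, gsrc (ginv g) = gtgt g ;
  gtgt_inv : forall g, gtgt (ginv g) = gsrc g ;
  gmul_invl : forall g, gmul (ginv g) g = gid (gsrc g) ;
  gmul_invr : forall g, gmul g (ginv g) = gid (gtgt g) }.

Definition quasi_polish_groupoid (G0 G : topologicalType)
  (Gam : topGroupoid G0 G) : Prop := quasi_polish (@open G).

Definition open_groupoid (G0 G : topologicalType)
  (Gam : topGroupoid G0 G) : Prop :=
  forall U : set G, open U -> open (gsrc Gam @` U).

Section GSpace.
Variables (G0 G : topologicalType) (Gam : topGroupoid G0 G).
Variables (X : Type) (p : X -> G0).

Definition fiber_prod (U : set G) (A : set X) : set (G * X) :=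
  [set ga | [/\ U ga.1, A ga.2 & gsrc Gam ga.1 = p ga.2]].

Definition fiber_tensor (T : set (set G)) (S : set (set X)) :
    set (set (G * X)) :=
  countable_unions [set fiber_prod U A | U in T & A in S].

(* Likewise [act g a] is meaningful only when [gsrc Gam g = p a]. *)
Variable act : G -> X -> X.

Definition act_preimage (A : set X) : set (G * X) :=
  fiber_prod setT setT `&` [set ga | A (act ga.1 ga.2)].

Record borel_gspace (BX : set (set X)) : Prop := BorelGSpace {
  gspace_standard : standard_borel BX ;
  gspace_anchor_borel : forall B, <<s @open G0 >> B -> BX (p @^-1` B) ;
  (* Borel sets of the fiber product: traces of the product sigma-algebra *)
  gspace_act_borel : forall A, BX A ->
    exists2 W, <<s [set U `*` B | U in <<s @open G >> & B in BX] >> W &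
      act_preimage A = fiber_prod setT setT `&` W ;
  gspace_anchor_act : forall g a, gsrc Gam g = p a ->
    p (act g a) = gtgt Gam g ;
  gspace_actA : forall g h a, gsrc Gam g = gtgt Gam h -> gsrc Gam h = p a ->
    act (gmul Gam g h) a = act g (act h a) ;
  gspace_act_id : forall a, act (gid Gam (p a)) a = a }.

Definition translate (g : G) (A : set X) : set X :=
  [set act g b | b in [set b | A b /\ gsrc Gam g = p b]].

Definition vaught (U : set G) (A : set X) : set X :=
  [set a | nonmeager_in (gtgt Gam @^-1` [set p a])
             [set g | U g /\ translate g A a]].

Definition vaught_unions (S : set (set X)) : set (set X) :=
  countable_unions [set vaught U A | U in @open G & A in S].

Definition invariant_set (A : set X) : Prop :=
  forall g a, gsrc Gam g = p a -> A a -> A (act g a).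

(* Joint continuity for the topology induced on the fiber product by the
   product of the topology of G with O. *)
Definition act_continuous (O : set (set X)) : Prop :=
  forall V, O V -> forall g a, gsrc Gam g = p a -> V (act g a) ->
    exists U W, [/\ open U, O W, U g, W a &
      fiber_prod U W `<=` act_preimage V].

Definition topological_realization (S O : set (set X)) : Prop :=
  [/\ quasi_polish O, O `<=` S,
      forall U : set G0, open U -> O (p @^-1` U) & act_continuous O].

End GSpace.

(* Main.v *)
Require Import Defs.
From mathcomp Require Import all_boot all_order all_algebra.
From mathcomp Require Import boolp classical_sets functions cardinality.
From mathcomp Require Import reals topology measure Rstruct lra.

(* The key formula is that act g y lies in V * A iff there are basic open u, w
   with g in u, u w included in V and y in w * A; it follows by translating the
   fiber over the target of g, and gives the passage from (ii) to (iv).  That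
   (iii) implies (ii) is the Baire category theorem in the fibers of the target
   map.

   For (ii) implies (i), compatibility yields an increasing sequence of
   quasi-Polish topologies included in S whose union has a countable basis A_a
   such that every U_u * A_a, for U_u in a countable basis of G, is again open.
   The sets U_u * A_a generate the required topology.  To see that it is
   quasi-Polish, describe a point x by the set phi of all pairs (u, a) with
   x in U_u * A_a.  Such sets satisfy countably many axioms "a finite set of
   pairs in phi forces one of countably many pairs into phi".  Conversely, if
   phi satisfies the axioms, a sufficiently generic decreasing sequence of
   pairs in phi converges to some (g, y) with src g = p y, and the key formula
   shows that act g y is described by phi.  Points with the same description
   coincide since their orbit maps have the Baire property. *)

Set Implicit Arguments.
Unset Strict Implicit.
Unset Printing Implicit Defensive.

Import Order.TTheory GRing.Theory Num.Theory.
Local Open Scope classical_set_scope.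

Local Notation R := Rdefinitions.R.

(** * Generic sequences and countability *)

Lemma generic_sequence (I : Type) (D : set I) (le : I -> I -> Prop)
    (Req : nat -> I -> I -> Prop) :
  (forall i, le i i) -> (forall i j k, le i j -> le j k -> le i k) ->
  D !=set0 ->
  (forall n i, D i -> exists j, [/\ D j, le j i & Req n i j]) ->
  exists s : nat -> I, [/\ forall n, D (s n),
    forall m n, (m <= n)%N -> le (s n) (s m)
    & forall n, Req n (s n) (s n.+1)].
Proof.
move=> lexx letr [i0 Di0] step.
have /choice[f fP] : forall ni : nat * I, exists j,
    D ni.2 -> [/\ D j, le j ni.2 & Req ni.1 ni.2 j].
  move=> [n i] /=; have [Di|nDi] := pselect (D i); last by exists i0.
  by have [j jP] := step n i Di; exists j.
pose s := fix s n := if n is m.+1 then f (m, s m) else i0.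
have Ds n : D (s n) by elim: n => //= n IH; case: (fP (n, s n) IH).
exists s; split => // [m n|n]; last by case: (fP (n, s n) (Ds n)).
elim: n => [|n IH]; first by rewrite leqn0 => /eqP->.
rewrite leq_eqVlt => /orP[/eqP->//|]; rewrite ltnS => /IH.
by apply: letr; case: (fP (n, s n) (Ds n)).
Qed.

(** A requirement may become applicable only late, so each one has to recur. Stage [n] treats the
    requirement coded by the first entry of the sequence that [n] codes; the second entry, an
    arbitrary [N] bounded by [n], makes such stages arbitrarily late. *)
Lemma generic_sequence_countType (I : Type) (K : countType) (D : set I)
    (le : I -> I -> Prop) (Req : K -> I -> I -> Prop) :
  (forall i, le i i) -> (forall i j k, le i j -> le j k -> le i k) ->
  D !=set0 ->
  (forall k i, D i -> exists j, [/\ D j, le j i & Req k i j]) ->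
  exists s : nat -> I, [/\ forall n, D (s n),
    forall m n, (m <= n)%N -> le (s n) (s m)
    & forall k N, exists2 n, (N <= n)%N & Req k (s n) (s n.+1)].
Proof.
move=> lexx letr D0 step.
pose r n : option K := unpickle (nth 0 (CodeSeq.decode n) 0).
have [|s [Ds les Rs]] := @generic_sequence I D le
  (fun n i j => if r n is Some k then Req k i j else True) lexx letr D0.
  move=> n i Di; case: (r n) => [k|]; first exact: step.
  by exists i; split.
exists s; split => // k N; pose n := CodeSeq.code [:: pickle k; N].
exists n; last by move: (Rs n); rewrite /r /n CodeSeq.codeK /= pickleK.
have := CodeSeq.gtn_decode n; rewrite CodeSeq.codeK /= => /and3P[_ + _].
exact: ltnW.
Qed.

Lemma countable_range (T : Type) (D : set T) (x0 : T) : countable D -> D x0 ->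
  exists2 f : nat -> T, (forall n, D (f n)) & forall x, D x -> exists n, f n = x.
Proof.
move=> /countable_injP[h hinj] Dx0.
have /choice[f fP] : forall n, exists x,
    D x /\ ((exists2 y, D y & h y = n) -> h x = n).
  move=> n; have [[y Dy yn]|no] := pselect (exists2 y, D y & h y = n).
    by exists y.
  by exists x0; split.
exists f => [n|x Dx]; first by case: (fP n).
exists (h x); have [Df /(_ (ex_intro2 _ _ x Dx erefl))] := fP (h x).
by apply: hinj; rewrite inE.
Qed.

Lemma countable_setU (T : Type) (A B : set T) :
  countable A -> countable B -> countable (A `|` B).
Proof.
move=> cA cB; have -> : A `|` B = \bigcup_b (if b then A else B).
  apply/seteqP; split => [x [Ax|Bx]|x [[] _ Ex]].
  - by exists true.
  - by exists false.
  - by left.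
  - by right.
by apply: bigcup_countable => [|[]//]; exact: countableP.
Qed.

Lemma countable_image_countType (I : countType) (T : Type) (f : I -> T)
    (D : set I) : countable (f @` D).
Proof. exact: sub_countable (card_image_le _ _) (countableP _). Qed.

Lemma countable_unions_index (J T : Type) (D : set J) (E : J -> set T)
    (F : set (set T)) :
  countable D -> (forall j, D j -> F (E j)) ->
  countable_unions F (\bigcup_(j in D) E j).
Proof.
move=> cD FE; exists (E @` D); split.
- exact: sub_countable (card_image_le _ _) cD.
- by move=> _ [j Dj <-]; exact: FE.
- apply/seteqP; split => [x [j Dj Ex]|x [_ [j Dj <-] Ex]].
    by exists (E j) => //; exists j.
  by exists j.
Qed.

(** * Bases presented by countably many coverings *)

Definition family_open (I T : Type) (B : I -> set T) (V : set T) : Prop :=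
  forall x, V x -> exists2 i, B i x & B i `<=` V.

Definition family_separates (I T : Type) (B : I -> set T) : Prop :=
  forall x y, (forall i, B i x <-> B i y) -> x = y.

Definition index_filter (I T : Type) (B : I -> set T) (F : set I) : Prop :=
  [/\ F !=set0, forall i j, F i -> B i `<=` B j -> F j
    & forall i j, F i -> F j -> exists2 k, F k & B k `<=` B i `&` B j].

(* A family of open sets presented by countably many covering relations: every
   filter of indices meeting all the coverings is the trace of a point. *)
Definition cover_complete (I K T : Type) (B : I -> set T)
    (C : K -> I -> I -> Prop) : Prop :=
  [/\ forall k i j, C k i j -> B j `<=` B i,
      forall k i x, B i x -> exists2 j, C k i j & B j x
    & forall F, index_filter B F ->
        (forall k i, F i -> exists2 j, F j & C k i j) ->
        exists x, forall i, F i <-> B i x].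

(** One countable index type serves all topologies, so that a sequence of them can be stacked over
    [nat * seq nat]; with finite sequences as indices, meets are available by concatenation. *)
Record presented_basis (T : Type) (B : seq nat -> set T) : Prop :=
  PresentedBasis {
    basis_nil : B [::] = setT ;
    basis_cat : forall s t, B (s ++ t) = B s `&` B t ;
    basis_separates : family_separates B ;
    basis_complete : exists C : nat -> _, cover_complete B C }.

Lemma family_open_mono (I J T : Type) (B : I -> set T) (B' : J -> set T) V :
  (forall i, family_open B' (B i)) -> family_open B V -> family_open B' V.
Proof.
move=> BB' oV x /oV[i Bix iV]; have [j Bjx ji] := BB' i x Bix.
by exists j => //; exact: subset_trans iV.
Qed.

Definition finite_meet (I : eqType) (X : Type) (B : I -> set X) (s : seq I) :
  set X := [set x | forall i, i \in s -> B i x].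

Lemma finite_meet_cat (I : eqType) (X : Type) (B : I -> set X) (s t : seq I) :
  finite_meet B (s ++ t) = finite_meet B s `&` finite_meet B t.
Proof.
apply/seteqP; split => [x Bx|x [Bs Bt] i].
  by split => i ist; apply: Bx; rewrite mem_cat ist ?orbT.
by rewrite mem_cat => /orP[/Bs|/Bt].
Qed.

Lemma finite_meet1 (I : eqType) (X : Type) (B : I -> set X) (i : I) :
  finite_meet B [:: i] = B i.
Proof.
apply/seteqP; split => [x /(_ i)|x Bx j]; first by apply; rewrite mem_head.
by rewrite inE => /eqP->.
Qed.

Lemma small_invSn (e : R) : (0 < e -> exists n : nat, n.+1%:R^-1 < e)%R.
Proof.
move=> e0; exists (Num.bound e^-1); rewrite invf_plt ?posrE ?ltr0n//.
apply: lt_le_trans (archi_boundP _) _; first by rewrite invr_ge0 ltW.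
by rewrite ler_nat.
Qed.

(** * Presented bases of quasi-Polish topologies *)

Section QuasiPolishBasis.
Local Open Scope ring_scope.
Variables (T : Type) (O : set (set T)) (d : T -> T -> R).
Hypotheses (dq : quasi_metric d) (dO : induces_topology d O).

Lemma quasi_metric_xx x : d x x = 0.
Proof. by have [_ /(_ erefl)[]] := quasi_metric_eq0 dq x x. Qed.

Lemma open_quasi_ball x e : O [set y | d x y < e].
Proof.
apply/dO => y /= xy; exists (e - d x y); first by rewrite subr_gt0.
move=> z /= yz; apply: le_lt_trans (quasi_metric_triangle dq x y z) _.
lra.
Qed.

Lemma induced_openT : O setT. Proof. by apply/dO => x _; exists 1. Qed.

Lemma induced_openI U V : O U -> O V -> O (U `&` V).
Proof.
move=> /dO oU /dO oV; apply/dO => x [/oU[e e0 eU] /oV[f f0 fV]].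
exists (Num.min e f); first by rewrite lt_min e0 f0.
by move=> y /=; rewrite lt_min => /andP[ye yf]; split; [apply: eU|apply: fV].
Qed.

Lemma induced_open_bigcup (J : Type) (D : set J) (E : J -> set T) :
  (forall j, D j -> O (E j)) -> O (\bigcup_(j in D) E j).
Proof.
move=> oE; apply/dO => x [j Dj Ex]; have /dO/(_ x Ex)[e e0 eE] := oE j Dj.
by exists e => // y /eE ?; exists j.
Qed.

(** The [k]-th covering shrinks a basic set into a ball of radius below 1/(k+1). A filter meeting
    all coverings contains a cofinal decreasing sequence of such sets; their centers form a
    quasi-Cauchy sequence, and its Smyth limit is the point sought. *)
Lemma quasi_polish_basis_metric : countably_based O -> quasi_complete d ->
  exists B : seq nat -> set T, [/\ presented_basis B,
    forall s, O (B s) & forall V, O V -> family_open B V].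
Proof.
move=> [B0 [cB0 B0O B0b]] dc.
(* Adding [setT] makes the base nonempty, so that [nat] can enumerate it. *)
have [||V VP Vs] := @countable_range _ (B0 `|` [set setT]) setT.
- by apply: countable_setU => //; exact: countable1.
- by right.
pose B := finite_meet V.
have VO n : O (V n) by case: (VP n) => [/B0O//|->]; exact: induced_openT.
have Bnil : B [::] = setT by apply/seteqP; split.
have Bcat s t : B (s ++ t) = B s `&` B t by exact: finite_meet_cat.
have BO s : O (B s).
  elim: s => [|i s IH]; first by rewrite Bnil; exact: induced_openT.
  by rewrite -cat1s Bcat /B finite_meet1; apply: induced_openI.
have Bb W : O W -> family_open B W.
  move=> OW x Wx; have [V' B0V' [V'x V'W]] := B0b W x OW Wx.
  have [n nV'] := Vs V' (or_introl B0V').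
  by exists [:: n]; rewrite /B finite_meet1 nV'.
(* The doubled radius leaves room for the limit: a point at distance less than [r] from a point of
   [B b] is still in [B a]. *)
pose C (k : nat) (a b : seq nat) (y : T) := B b y /\ exists r : R,
  [/\ 0 < r, r < k.+1%:R^-1, B b `<=` [set z | d y z < r]
    & [set z | d y z < r + r] `<=` B a].
have CB k a b y : C k a b y -> B b `<=` B a.
  move=> [_ [r [r0 _ br ra]]] z /br /= yz; apply: ra => /=; lra.
exists B; split => //; split => //.
  move=> x y xy.
  have half u v : (forall s, B s u <-> B s v) -> d u v = 0.
    move=> uv; apply/eqP; rewrite -[_ == _]negbK; apply/negP => duv.
    have d0 : 0 < d u v by rewrite lt_neqAle eq_sym duv (quasi_metric_ge0 dq).
    have [|s Bu /(_ v)] := Bb _ (open_quasi_ball u (d u v)) u.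
      by rewrite /= quasi_metric_xx.
    by rewrite /= ltxx => /(_ ((uv s).1 Bu)).
  apply/(quasi_metric_eq0 dq); split; apply: half => // s.
  by split => /xy.
exists (fun k a b => exists y, C k a b y); split.
- by move=> k a b [y /CB].
- move=> k a x Bax; have /dO/(_ x Bax)[e e0 eB] := BO a.
  pose r := Num.min (e / 2) (k.+2%:R^-1).
  have r0 : 0 < r by rewrite lt_min divr_gt0//= invr_gt0 ltr0n.
  have [|b Bbx br] := Bb _ (open_quasi_ball x r) x.
    by rewrite /= quasi_metric_xx.
  exists b => //; exists x; split => //; exists r; split => //.
    rewrite /r gt_min; apply/orP; right.
    by rewrite ltf_pV2 ?posrE ?ltr0n// ltr_nat.
  move=> z /= xz; apply: eB => /=.
  have re : r <= e / 2 by rewrite ge_min lexx.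
  lra.
move=> F [[a0 Fa0] Fup Fdir] Fcov.
have [dec decK] : exists dec : nat -> option (seq nat),
    forall b, dec (pickle b) = Some b by exists unpickle; exact: pickleK.
(* Stage [n] goes below the index coded by [n] if it is in [F], which makes the sequence cofinal in
   [F], and records a center for the [n]-th covering. The starting state has no center, whence the
   summand [unit]. *)
have [||||s [Ds les Rs]] := @generic_sequence (seq nat * (T + unit))
    [set i | F i.1] (fun i j => B i.1 `<=` B j.1)
    (fun n i j => (if dec n is Some e then F e -> B j.1 `<=` B e else True)
       /\ exists2 y, j.2 = inl y & C n i.1 j.1 y).
- by move=> i x.
- by move=> i j k; exact: subset_trans.
- by exists (a0, inr tt).
- move=> n [a z] /= Fa.
  have [c Fc [ca ce]] : exists2 c, F c & B c `<=` B a /\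
      (if dec n is Some e then F e -> B c `<=` B e else True).
    case: (dec n) => [e|]; last by exists a => //; split.
    have [Fe|nFe] := pselect (F e); last by exists a => //; split.
    have [c Fc cae] := Fdir a e Fa Fe; exists c => //.
    by split => [x /cae[]|_ x /cae[]].
  have [b Fb [y [Bby [r [r0 rn br rc]]]]] := Fcov n c Fc.
  have bc : B b `<=` B c by move=> x /br /= yx; apply: rc => /=; lra.
  exists (b, inl y); split => //=; first exact: subset_trans bc ca.
  split.
    by case: (dec n) ce => // e ce Fe; exact: subset_trans bc (ce Fe).
  exists y => //; split => //; exists r; split => //.
  exact: subset_trans rc ca.
have /choice[u uP] n : exists y, C n (s n).1 (s n.+1).1 y.
  by have [_ [y _ ?]] := Rs n; exists y.
(* All later centers lie in the ball about the center [u m], which gives the Cauchy condition. *)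
have uB m n : (m <= n)%N -> B (s m.+1).1 (u n).
  by move=> mn; have [Bu _] := uP n; apply: les Bu.
have [|x xP] := dc u.
  move=> e /small_invSn[N Ne]; exists N => m n Nm mn.
  have [_ [r [_ rm br _]]] := uP m.
  have /= := br _ (uB _ _ mn); move=> /lt_trans; apply.
  apply: lt_trans rm _; apply: le_lt_trans Ne.
  by rewrite lef_pV2 ?posrE ?ltr0n// ler_nat.
have conv e : 0 < e -> exists N, forall n, (N <= n)%N ->
    d x (u n) < e /\ d (u n) x < e.
  move=> e0; have [N NP] := xP e e0; exists N => n /NP.
  by rewrite gt_max => /andP.
have tail b : F b -> exists n, B (s n.+1).1 `<=` B b.
  by move=> Fb; exists (pickle b); have [+ _] := Rs (pickle b);
     rewrite decK; exact.
exists x => a; split.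
  move=> Fa; have [b Fb [z [_ [r [r0 _ br ra]]]]] := Fcov 0%N a Fa.
  have [n nb] := tail b Fb; have [N NP] := conv r r0.
  apply: ra => /=.
  apply: le_lt_trans (quasi_metric_triangle dq z (u (maxn n N)) x) _.
  apply: ltrD; last by have [] := NP (maxn n N) (leq_maxr _ _).
  by apply: br; apply: nb; apply: uB; exact: leq_maxl.
move=> Bax; have /dO/(_ x Bax)[e e0 eB] := BO a.
have e2 : 0 < e / 2 by rewrite divr_gt0.
have [N NP] := conv _ e2.
have [M Me] := small_invSn e2.
pose n := maxn M N; apply: (Fup (s n.+1).1) (Ds _) _ => z Bz; apply: eB => /=.
have [_ [r [_ rn br _]]] := uP n.
have := br _ Bz => /= unz; have [xu _] := NP n (leq_maxr _ _).
have nM : n.+1%:R^-1 <= M.+1%:R^-1 :> R.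
  by rewrite lef_pV2 ?posrE ?ltr0n// ler_nat ltnS leq_maxl.
have {rn nM} re : r < e / 2 by apply: lt_trans rn _; exact: le_lt_trans nM Me.
have := quasi_metric_triangle dq x (u n) z.
lra.
Qed.

End QuasiPolishBasis.

Lemma quasi_polish_basis (T : Type) (O : set (set T)) : quasi_polish O ->
  exists B : seq nat -> set T, [/\ presented_basis B,
    forall s, O (B s) & forall V, O V -> family_open B V].
Proof.
by move=> [cb [d [dq dc dO]]]; exact: quasi_polish_basis_metric dO cb dc.
Qed.

(** * Joins of increasing sequences of topologies *)

Lemma increasing_family_open (I T : Type) (B : nat -> I -> set T) :
  (forall m i, family_open (B m.+1) (B m i)) ->
  forall m n i, (m <= n)%N -> family_open (B n) (B m i).
Proof.
move=> Binc m n i; elim: n => [|n IH].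
  by rewrite leqn0 => /eqP-> x Bx; exists i.
rewrite leq_eqVlt => /orP[/eqP->|]; first by move=> x Bx; exists i.
by rewrite ltnS => /IH; apply: family_open_mono.
Qed.

(** A filter on the stacked indices restricts at each level to a filter meeting the coverings of
    that level, hence to the trace of a point [y m]. The coverings that lift an index to a higher
    level force all these points to coincide. *)
Lemma increasing_cover_complete (T : Type) (B : nat -> seq nat -> set T) :
  (forall m, presented_basis (B m)) ->
  (forall m s, family_open (B m.+1) (B m s)) ->
  exists C : nat * nat -> _,
    cover_complete (fun i : nat * seq nat => B i.1 i.2) C.
Proof.
move=> Bp Binc.
have {}Binc := increasing_family_open Binc.
have /choice[C CP] := fun m => basis_complete (Bp m).
pose A (i : nat * seq nat) := B i.1 i.2.
(* The covering [(m, k)] lifts indices of level below [m] to level [m], applies the [k]-th covering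
   of level [m] at that level, and only asks for a subset above it. *)
exists (fun (mk : nat * nat) (i j : nat * seq nat) =>
  [/\ A j `<=` A i, (i.1 <= mk.1)%N -> j.1 = mk.1
    & i.1 = mk.1 -> C mk.1 mk.2 i.2 j.2]).
split.
- by move=> mk i j [].
- move=> [m k] [n s] x /= Bx; case: (ltngtP n m) => [nm|mn|nm].
  + have [t Bt ts] := Binc _ _ s (ltnW nm) x Bx.
    by exists (m, t) => //; split => //= nm'; rewrite nm' ltnn in nm.
  + by exists (n, s) => //; split => //= nm'; rewrite nm' ltnn in mn.
  + subst n; have [Csub Ccov _] := CP m; have [t Ct Bt] := Ccov k s x Bx.
    by exists (m, t) => //; split => //=; exact: Csub Ct.
move=> F [[[m0 s0] F0] Fup Fdir] Fcov.
have /choice[y yP] : forall m, exists y, forall s, F (m, s) <-> B m s y.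
  move=> m; have [_ _ Ccomp] := CP m; apply: (Ccomp [set s | F (m, s)]).
    split => /=.
    - by exists [::]; apply: Fup F0 _ => x _ /=; rewrite (basis_nil (Bp m)).
    - by move=> s t Fs st; apply: Fup Fs _.
    - move=> s t Fs Ft; have [c Fc cst] := Fdir _ _ Fs Ft.
      exists (s ++ t); last by rewrite (basis_cat (Bp m)).
      by apply: Fup Fc _ => x /cst; rewrite /= (basis_cat (Bp m)).
  move=> k s /= Fs; have [[n t] Ft [_ /= nm Ct]] := Fcov (m, k) (m, s) Fs.
  by move: (nm (leqnn _)) => nm'; subst n; exists t => //; exact: Ct.
exists (y 0%N) => -[m s] /=.
suff <- : y m = y 0%N by exact: yP.
apply: (basis_separates (Bp 0%N)) => t; split.
  move=> Bt; apply/yP; have [s' Bs' s't] := Binc 0%N m t (leq0n _) _ Bt.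
  by apply: (Fup (m, s') (0%N, t)) => //; apply/yP.
move=> /yP Ft; have [[n t'] Ft' [/= t't nm _]] := Fcov (m, 0%N) (0%N, t) Ft.
move: (nm (leq0n _)) => nm'; subst n.
by apply: t't; apply/yP.
Qed.

(** * Quasi-metrics from countably many preorders *)

Section PreorderMetric.
Local Open Scope ring_scope.
Variables (X : Type) (Rk : nat -> X -> X -> Prop).
Hypotheses (Rxx : forall k x, Rk k x x)
  (Rtr : forall k x y z, Rk k x y -> Rk k y z -> Rk k x z).

Definition preorder_dist (x y : X) : R :=
  match pselect (exists k, ~~ `[< Rk k x y >]) with
  | left h => (ex_minn h).+1%:R^-1
  | right _ => 0
  end.

(** If [m] is the first violated relation, the distance is 1/(m+1), which is below 1/(n+1) exactly
    when m > n; the bound [k <= n] is therefore inclusive. *)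
Lemma preorder_dist_lt n x y :
  preorder_dist x y < n.+1%:R^-1 <-> forall k, (k <= n)%N -> Rk k x y.
Proof.
rewrite /preorder_dist; case: pselect => [h|nh]; last first.
  split => [_ k _|_]; last by rewrite invr_gt0 ltr0n.
  by apply: contrapT => nR; apply: nh; exists k; apply/asboolPn.
case: ex_minnP => m /asboolPn nRm mmin.
rewrite ltf_pV2 ?posrE ?ltr0n// ltr_nat ltnS; split => [nm k kn|Rn].
  apply: contrapT => nR; have /mmin : ~~ `[< Rk k x y >] by apply/asboolPn.
  by rewrite leqNgt (leq_ltn_trans kn nm).
by rewrite ltnNge; apply/negP => /Rn.
Qed.

Lemma preorder_dist_ge0 x y : 0 <= preorder_dist x y.
Proof. by rewrite /preorder_dist; case: pselect => // h; rewrite invr_ge0. Qed.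

Lemma preorder_dist_eq0 x y : preorder_dist x y = 0 <-> forall k, Rk k x y.
Proof.
split => [d0 k|RR].
  by apply: ((preorder_dist_lt k x y).1 _ k) => //; rewrite d0 invr_gt0 ltr0n.
rewrite /preorder_dist; case: pselect => // -[k]; move/asboolPn => []; exact: RR.
Qed.

(** The triangle inequality holds in the ultrametric form: by transitivity, a relation violated by
    [x], [z] is violated by [x], [y] or by [y], [z]. *)
Lemma preorder_dist_quasi_metric :
  (forall x y, (forall k, Rk k x y) -> (forall k, Rk k y x) -> x = y) ->
  quasi_metric preorder_dist.
Proof.
move=> Ranti; split; first exact: preorder_dist_ge0.
- move=> x y; split => [[/preorder_dist_eq0 xy /preorder_dist_eq0 yx]|->].
    exact: Ranti.
  by split; apply/preorder_dist_eq0.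
- move=> x y z; case xz: (preorder_dist x z == 0).
    by rewrite (eqP xz) addr_ge0 // preorder_dist_ge0.
  move: xz; rewrite {1 2}/preorder_dist; case: pselect => [h|]; last by rewrite eqxx.
  case: ex_minnP => m /asboolPn nRm _ _; rewrite leNgt; apply/negP => lt.
  have xy : forall k, (k <= m)%N -> Rk k x y.
    apply/preorder_dist_lt; apply: le_lt_trans lt.
    by rewrite lerDl preorder_dist_ge0.
  have yz : forall k, (k <= m)%N -> Rk k y z.
    apply/preorder_dist_lt; apply: le_lt_trans lt.
    by rewrite lerDr preorder_dist_ge0.
  by apply: nRm; apply: Rtr (xy m _) (yz m _).
Qed.

Lemma preorder_dist_complete :
  (forall u : nat -> X,
     (forall k, exists N, forall m n, (N <= m)%N -> (m <= n)%N ->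
        Rk k (u m) (u n)) ->
     exists x, forall k, exists N, forall n, (N <= n)%N ->
       Rk k x (u n) /\ Rk k (u n) x) ->
  quasi_complete preorder_dist.
Proof.
move=> comp u uC.
have [k|x xP] := comp u.
  have [|N NP] := uC (k.+1%:R^-1); first by rewrite invr_gt0 ltr0n.
  by exists N => m n Nm mn; apply: ((preorder_dist_lt k _ _).1 (NP m n Nm mn)).
exists x => e /small_invSn[K Ke].
have [N NP] : exists N, forall n, (N <= n)%N -> forall k, (k <= K)%N ->
    Rk k x (u n) /\ Rk k (u n) x.
  elim: K {Ke} => [|K [N IH]].
    have [N NP] := xP 0%N; exists N => n Nn k.
    by rewrite leqn0 => /eqP->; exact: NP.
  have [M MP] := xP K.+1; exists (maxn M N) => n; rewrite geq_max => /andP[Mn Nn] k.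
  rewrite leq_eqVlt => /orP[/eqP->|]; first exact: MP.
  by rewrite ltnS; exact: IH.
exists N => n Nn; apply: lt_trans Ke; rewrite gt_max.
by apply/andP; split; apply/preorder_dist_lt => k kK; have [] := NP n Nn k kK.
Qed.

End PreorderMetric.

(** * Countably axiomatized spaces are quasi-Polish *)

Definition generated_topology (I : eqType) (X : Type) (B : I -> set X) :
  set (set X) := [set V | family_open (finite_meet B) V].

Lemma generated_topologyI (I : eqType) (X : Type) (B : I -> set X) U V :
  generated_topology B U -> generated_topology B V ->
  generated_topology B (U `&` V).
Proof.
move=> oU oV x [/oU[s Bs sU] /oV[t Bt tV]].
by exists (s ++ t); rewrite finite_meet_cat // => y [/sU ? /tV ?].
Qed.

Lemma generated_topologyT (I : eqType) (X : Type) (B : I -> set X) :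
  generated_topology B setT.
Proof. by move=> x _; exists [::]. Qed.

Lemma generated_topology_base (I : eqType) (X : Type) (B : I -> set X) i :
  generated_topology B (B i).
Proof. by move=> x Bx; exists [:: i]; rewrite finite_meet1. Qed.

(* De Brecht's description of quasi-Polish spaces as the Pi^0_2 subspaces of the
   powerset of a countable set: a point is the set phi of the indices i with
   B i x, and the axiom k reads "P k included in phi implies that phi meets
   Q k". *)
Section CountablyAxiomatized.
Variables (X : Type) (I K : countType) (B : I -> set X).
Variables (P : K -> seq I) (Q : K -> set I).
Hypothesis axiom_valid : forall k x, finite_meet B (P k) x ->
  exists2 i, Q k i & B i x.
Hypothesis B_separates : family_separates B.
Hypothesis axiom_realized : forall phi : set I,
  (forall k, (forall i, i \in P k -> phi i) -> exists2 i, Q k i & phi i) ->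
  exists x, forall i, phi i <-> B i x.

(** Along a sequence the witnesses of an axiom could have unbounded codes and be lost in the limit.
    Preserving these sets forbids it: past some term, a bound on the code of a witness stays
    valid. *)
Let bounded k j : set X :=
  finite_meet B (P k) `&` [set x | exists i, [/\ (pickle i <= j)%N, Q k i & B i x]].

Let Rk (n : nat) (x y : X) : Prop :=
  match unpickle n : option (I + K) with
  | None => True
  | Some (inl i) => B i x -> B i y
  | Some (inr k) => forall j, bounded k j x -> bounded k j y
  end.

Let RI i x y : Rk (pickle (inl i : I + K)) x y = (B i x -> B i y).
Proof. by rewrite /Rk pickleK. Qed.

Let RK k x y : Rk (pickle (inr k : I + K)) x y =
  (forall j, bounded k j x -> bounded k j y).
Proof. by rewrite /Rk pickleK. Qed.

Let Rxx n x : Rk n x x.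
Proof. by rewrite /Rk; case: unpickle => // -[]. Qed.

Let Rtr n x y z : Rk n x y -> Rk n y z -> Rk n x z.
Proof.
rewrite /Rk; case: unpickle => // -[i xy yz /xy/yz//|k xy yz j /xy].
exact: yz.
Qed.

Let pickle_bound (s : seq I) : exists j, forall i, i \in s -> (pickle i <= j)%N.
Proof.
elim: s => [|i s [j jP]]; first by exists 0%N.
exists (maxn (pickle i) j) => i'; rewrite inE leq_max => /orP[/eqP->|/jP->].
  by rewrite leqnn.
by rewrite orbT.
Qed.

(** For an axiom whose premise holds at [x], the premise together with the witness of least code is
    a suitable neighborhood, as this code is below every bound valid at [x]. If the premise fails
    there is nothing to preserve. *)
Let Rk_nbhs n x : exists2 s, finite_meet B s x &
  finite_meet B s `<=` [set y | Rk n x y].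
Proof.
rewrite /Rk; case: (unpickle n) => [[i|k]|]; last by exists [::].
  have [Bx|nBx] := pselect (B i x).
    by exists [:: i]; rewrite finite_meet1 // => y By.
  by exists [::] => // y _ /nBx.
have [Px|nPx] := pselect (finite_meet B (P k) x); last first.
  by exists [::] => // y _ j /= [].
have ex : exists j, `[< exists i, [/\ pickle i = j, Q k i & B i x] >].
  by have [i Qi Bi] := axiom_valid Px; exists (pickle i); apply/asboolP; exists i.
have [_ /asboolP[i [<- Qi Bi] imin]] := ex_minnP ex.
exists (P k ++ [:: i]); rewrite finite_meet_cat finite_meet1 // => y [Py By] j.
move=> [_ [i' [i'j Qi' Bi']]]; split => //; exists i; split => //.
by apply: leq_trans (imin _ _) i'j; apply/asboolP; exists i'.
Qed.

(** The limit is described by the indices that eventually hold along [u]; monotonicity makes each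
    index stabilize, and the bounds on witnesses make this description satisfy the axioms. *)
Let Rk_complete (u : nat -> X) :
  (forall k, exists N, forall m n, (N <= m)%N -> (m <= n)%N ->
     Rk k (u m) (u n)) ->
  exists x, forall k, exists N, forall n, (N <= n)%N ->
    Rk k x (u n) /\ Rk k (u n) x.
Proof.
move=> uC.
pose phi : set I := [set i | exists N, forall n, (N <= n)%N -> B i (u n)].
have stab1 i : exists N, forall n, (N <= n)%N -> (B i (u n) <-> phi i).
  have [N NP] := uC (pickle (inl i : I + K)).
  have [phii|nphi] := pselect (phi i).
    by have [M MP] := phii; exists M => n Mn; split => // _; exact: MP.
  exists N => n Nn; split => // Bun; exists n => m nm.
  by have := NP n m Nn nm; rewrite RI; exact.
have stab j : exists N, forall n, (N <= n)%N -> forall i, (pickle i <= j)%N ->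
    (B i (u n) <-> phi i).
  have one l : exists N, forall n, (N <= n)%N -> forall i : I, pickle i = l ->
      (B i (u n) <-> phi i).
    have [[i il]|no] := pselect (exists i : I, pickle i = l).
      have [N NP] := stab1 i; exists N => n Nn i' i'l.
      have -> : i' = i by apply: (pcan_inj pickleK); rewrite il.
      exact: NP.
    by exists 0%N => n _ i il; case: no; exists i.
  elim: j => [|j [N IH]].
    have [N NP] := one 0%N; exists N => n Nn i; rewrite leqn0 => /eqP.
    exact: NP.
  have [M MP] := one j.+1; exists (maxn M N) => n.
  rewrite geq_max => /andP[Mn Nn] i; rewrite leq_eqVlt => /orP[/eqP|].
    exact: MP.
  by rewrite ltnS; exact: IH.
have stabs k j : exists N, forall n, (N <= n)%N -> forall i,
    (i \in P k) || (pickle i <= j)%N -> (B i (u n) <-> phi i).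
  have [l lP] := pickle_bound (P k); have [N NP] := stab (maxn l j).
  exists N => n Nn i /orP ilj; apply: NP => //; rewrite leq_max.
  by case: ilj => [/lP->//|->]; rewrite orbT.
have [k Pphi|x xP] := axiom_realized (phi := phi).
  (* A witness at [u m] bounds the codes of witnesses at all later terms. Only finitely many codes
     are below the bound; once they have stabilized, a witness belongs to [phi]. *)
  have [N NP] := uC (pickle (inr k : I + K)).
  have [M MP] := stabs k 0%N.
  pose m := maxn M N.
  have Pum : finite_meet B (P k) (u m).
    by move=> i iP; apply/(MP m); rewrite ?leq_maxl ?iP //; exact: Pphi.
  have [i Qi Bi] := axiom_valid Pum.
  have [L LP] := stab (pickle i).
  have := NP m (maxn L m) (leq_maxr _ _) (leq_maxr _ _); rewrite RK.
  move=> /(_ (pickle i))[|_ [i' [i'i Qi' Bi']]]; first by split => //; exists i.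
  by exists i' => //; apply/(LP (maxn L m)) => //; exact: leq_maxl.
exists x => n; case nE : (unpickle n : option (I + K)) => [[i|k]|]; last first.
- by exists 0%N => m _; rewrite /Rk nE.
- have [N NP] := uC n; have [x' x'P x's] := Rk_nbhs n x.
  have [l lP] := pickle_bound x'; have [M MP] := stab l.
  exists (maxn M N) => m; rewrite geq_max => /andP[Mm Nm]; split.
    apply: x's => i ix'; apply/(MP m Mm); first exact: lP.
    by apply/xP; exact: x'P.
  rewrite /Rk nE => j [Pum [i [ij Qi Bi]]].
  (* The bound passes from [u m] to [x] through a later term, at which the premise and all codes up
     to [j] agree with [phi]. *)
  have [L LP] := stabs k j.
  have := NP m (maxn L m) Nm (leq_maxr _ _); rewrite /Rk nE => /(_ j)[|].
    by split => //; exists i.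
  move=> PuL [i' [i'j Qi' Bi']].
  have agree i0 : (i0 \in P k) || (pickle i0 <= j)%N -> B i0 (u (maxn L m)) ->
      B i0 x.
    by move=> i0P; rewrite (LP _ (leq_maxl _ _) i0 i0P) => /xP.
  split; last by exists i'; split => //; apply: agree => //; rewrite i'j orbT.
  by move=> i0 i0P; apply: agree; [rewrite i0P|exact: PuL].
- have [N NP] := stab1 i; exists N => m Nm; rewrite /Rk nE.
  by have := NP m Nm; have := xP i; tauto.
Qed.

(** The two topologies agree: preservation of each [B i] is among the relations controlled by a
    small enough ball, and conversely a ball of radius 1/(n+1) only involves the first n+1
    relations, each having a neighborhood by [Rk_nbhs]. *)
Theorem countably_axiomatized_quasi_polish :
  quasi_polish (generated_topology B).
Proof.
split.
  exists (range (finite_meet B)); split.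
  - exact: countable_image_countType.
  - move=> _ [s _ <-]; elim: s => [|i s IH].
      suff -> : finite_meet B [::] = setT by exact: generated_topologyT.
      by apply/seteqP; split.
    rewrite -cat1s finite_meet_cat finite_meet1; apply: generated_topologyI => //.
    exact: generated_topology_base.
  - move=> U x oU Ux; have [s sx sU] := oU x Ux.
    by exists (finite_meet B s).
exists (preorder_dist Rk); split.
- apply: preorder_dist_quasi_metric => // x y xy yx; apply: B_separates => i.
  by have := xy (pickle (inl i : I + K)); have := yx (pickle (inl i : I + K));
     rewrite !RI.
- exact: preorder_dist_complete.
- move=> U; split => oU x Ux.
    have [s sx sU] := oU x Ux.
    have [n nP] : exists n, forall i, i \in s -> (pickle (inl i : I + K) <= n)%N.
      elim: s {sx sU} => [|i s [n nP]]; first by exists 0%N.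
      exists (maxn (pickle (inl i : I + K)) n) => j.
      by rewrite inE leq_max => /orP[/eqP->|/nP->]; rewrite ?leqnn ?orbT.
    exists (n.+1%:R^-1)%R; first by rewrite invr_gt0 ltr0n.
    move=> y /= /preorder_dist_lt xy; apply: sU => i si.
    by have := xy _ (nP i si); rewrite RI; apply; exact: sx.
  have [e /small_invSn[n ne] eU] := oU x Ux.
  have [s sx sR] : exists2 s, finite_meet B s x & finite_meet B s `<=`
      [set y | forall k, (k <= n)%N -> Rk k x y].
    elim: n {ne} => [|n [s sx sR]].
      have [s sx sR] := Rk_nbhs 0 x; exists s => // y /sR /= Ry k.
      by rewrite leqn0 => /eqP->.
    have [t tx tR] := Rk_nbhs n.+1 x; exists (s ++ t).
      by rewrite finite_meet_cat.
    rewrite finite_meet_cat => y [/sR /= sy /tR /= ty] k.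
    by rewrite leq_eqVlt => /orP[/eqP->//|]; rewrite ltnS; exact: sy.
  exists s => // y /sR /= Ry; apply: eU => /=; apply: lt_trans ne.
  by apply/preorder_dist_lt.
Qed.

End CountablyAxiomatized.

(** * Baire category relative to a subset *)

Section RelativeCategory.
Variable T : topologicalType.
Implicit Types (Y E V W : set T).

(** Formulated with open sets of [T], so that no set or map has to be restricted to the subspace
    type. *)
Definition nowhere_dense_in Y E : Prop :=
  forall V, open V -> (V `&` Y) !=set0 ->
    exists W, [/\ open W, W `<=` V, (W `&` Y) !=set0 & W `&` Y `<=` ~` E].

Definition meager_in Y E : Prop :=
  exists2 F : nat -> set T, (forall n, nowhere_dense_in Y (F n)) &
    Y `&` E `<=` \bigcup_n F n.

Lemma nonmeager_inP Y E : nonmeager_in Y E <-> ~ meager_in Y E.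
Proof.
apply: not_iff_compat; split => [[F Fn EF]|[F Fn EF]].
  exists (fun n => set_val @` F n) => [n V oV [y [Vy Yy]]|y [Yy Ey]]; last first.
    have : [set y : set_type Y | E (set_val y)] (exist _ y (mem_set Yy)).
      by rewrite /= set_valE.
    by rewrite EF => -[n _ Fy]; exists n => //; exists (exist _ y (mem_set Yy)).
  pose y' : set_type Y := exist _ y (mem_set Yy).
  have : ~ interior (closure (F n)) y' by rewrite (Fn n).
  move=> nint.
  have [z [Vz nz]] : exists z, V (set_val z) /\ ~ closure (F n) z.
    apply: contrapT => no; apply: nint; exists (set_val @^-1` V); split => /=.
    - by exists V.
    - by rewrite set_valE.
    - by move=> z Vz; apply: contrapT => nz; apply: no; exists z.
  have [W [oW Wz WF]] : exists W, [/\ open W, W (set_val z) &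
      forall t, W (set_val t) -> ~ F n t].
    apply: contrapT => no; apply: nz => D [_ [/= [W oW <-] Wz WD]].
    apply: contrapT => nWF; apply: no; exists W; split => // t Wt Ft.
    by apply: nWF; exists t; split => //; exact: WD.
  exists (W `&` V); split.
  - exact: openI.
  - by move=> t [].
  - by exists (set_val z); split => //; exact/set_mem/(valP z).
  - by move=> t [[Wt _] Yt] [t' Ft' t't]; apply: WF Ft'; rewrite t't.
(* [meager] asks for an equality, hence the intersection with [E]. *)
exists (fun n => [set y | E (set_val y)] `&` set_val @^-1` (F n)) => [n|].
  apply/seteqP; split => // z [_ [/= [V oV <-] Vz VF]].
  have [|W [oW WV [w [Ww Yw]] WF]] := Fn n V oV.
    by exists (set_val z); split => //; exact/set_mem/(valP z).
  pose w' : set_type Y := exist _ w (mem_set Yw).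
  have wc : closure ([set y | E (set_val y)] `&` set_val @^-1` (F n)) w'.
    by apply: VF; rewrite /= set_valE; exact: WV.
  have [|t [[_ Ft] Wt]] := wc (set_val @^-1` W).
    by exists (set_val @^-1` W); split => //=; exists W.
  apply: (WF (set_val t)) Ft; split => //.
  exact/set_mem/(valP t).
apply/seteqP; split => [z Ez|z [n _ []]//].
have [|n _ Fz] := EF (set_val z); last by exists n.
by split => //; exact/set_mem/(valP z).
Qed.

Lemma nowhere_dense_in_meager Y E : nowhere_dense_in Y E -> meager_in Y E.
Proof. by move=> nE; exists (fun=> E) => // y [_ Ey]; exists 0%N. Qed.

Lemma meager_in_sub Y E E' : Y `&` E `<=` E' -> meager_in Y E' -> meager_in Y E.
Proof.
move=> EE' [F Fn E'F]; exists F => // y [Yy Ey]; apply: E'F; split => //.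
exact: EE'.
Qed.

Lemma meager_in0 Y : meager_in Y set0.
Proof.
by apply: nowhere_dense_in_meager => V oV VY; exists V; split => // y _ [].
Qed.

Lemma meager_in_bigcup (J : Type) (D : set J) Y (E : J -> set T) :
  countable D -> (forall j, D j -> meager_in Y (E j)) ->
  meager_in Y (\bigcup_(j in D) E j).
Proof.
move=> cD mE; have [[j0 Dj0]|D0] := pselect (D !=set0); last first.
  by apply: meager_in_sub (meager_in0 Y) => y [_ [j Dj _]]; case: D0; exists j.
have [f Df fs] := countable_range cD Dj0.
have /choice[F FP] n : exists F : nat -> set T,
    (forall m, nowhere_dense_in Y (F m)) /\ Y `&` E (f n) `<=` \bigcup_m F m.
  by have [F ? ?] := mE _ (Df n); exists F.
exists (fun k => if unpickle k is Some (n, m) then F n m else set0).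
  move=> k; case: (unpickle k : option (nat * nat)) => [[n m]|].
    by have [+ _] := FP n; exact.
  by move=> V oV VY; exists V; split => // y _ [].
move=> y [Yy [j Dj Ey]]; have [n nj] := fs j Dj; subst j.
have [_ /(_ y (conj Yy Ey))[m _ Fy]] := FP n.
by exists (pickle (n, m)) => //; rewrite pickleK.
Qed.

Lemma meager_inU Y E E' :
  meager_in Y E -> meager_in Y E' -> meager_in Y (E `|` E').
Proof.
move=> mE mE'.
apply: (meager_in_sub (E' := \bigcup_b if b then E else E')).
  by move=> y [_ [?|?]]; [exists true|exists false].
by apply: meager_in_bigcup => [|[]//]; exact: countableP.
Qed.

(** Inverse laws and continuity are required only relative to [Y] and [Y'], because a groupoid
    translation is meaningful on a single fiber only. *)
Lemma meager_in_homeo (f f' : T -> T) Y Y' E :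
  (forall y, Y y -> Y' (f y)) -> (forall y, Y' y -> Y (f' y)) ->
  (forall y, Y' y -> f (f' y) = y) -> (forall y, Y y -> f' (f y) = y) ->
  (forall y V, Y y -> open V -> V (f y) ->
     exists W, [/\ open W, W y & W `&` Y `<=` f @^-1` V]) ->
  (forall y V, Y' y -> open V -> V (f' y) ->
     exists W, [/\ open W, W y & W `&` Y' `<=` f' @^-1` V]) ->
  meager_in Y' E -> meager_in Y (f @^-1` E).
Proof.
move=> fY f'Y ff' f'f cf cf' [F Fn EF].
exists (fun n => f @^-1` (F n)) => [n V oV [y [Vy Yy]]|y [Yy Ey]]; last first.
  by have [|n _ Fy] := EF (f y); [split => //; exact: fY|exists n].
have [|W [oW Wy WV]] := cf' (f y) V (fY y Yy) oV; first by rewrite f'f.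
have [|W' [oW' W'W [z [Wz Yz]] W'F]] := Fn n W oW.
  by exists (f y); split => //; exact: fY.
have [|V' [oV' V'z V'W']] := cf (f' z) W' (f'Y z Yz) oW'; first by rewrite ff'.
exists (V' `&` V); split.
- exact: openI.
- by move=> t [].
- exists (f' z); split; last exact: f'Y.
  by split => //; apply: WV; split => //; exact: W'W.
- move=> t [[V't _] Yt]; apply: W'F; split; last exact: fY.
  exact: V'W'.
Qed.

Definition baire_property_in Y E : Prop :=
  exists2 V, open V & meager_in Y ((E `\` V) `|` (V `\` E)).

Lemma baire_property_open Y V : open V -> baire_property_in Y V.
Proof.
move=> oV; exists V => //; apply: meager_in_sub (meager_in0 Y).
by move=> y [_ [[]|[]]].
Qed.

Lemma baire_property_ext Y E E' : (forall y, Y y -> E y <-> E' y) ->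
  baire_property_in Y E -> baire_property_in Y E'.
Proof.
move=> EE' [V oV mV]; exists V => //; apply: meager_in_sub mV.
by move=> y [/EE' ? /=]; tauto.
Qed.

(** The complement is approximated by the exterior of [V] relative to [Y]; what is in neither [V]
    nor its exterior is a boundary, hence nowhere dense. *)
Lemma baire_propertyC Y E : baire_property_in Y E -> baire_property_in Y (~` E).
Proof.
move=> [V oV mV].
pose W := \bigcup_(U in [set U | open U /\ U `&` Y `<=` ~` V]) U.
have oW : open W by apply: bigcup_open => U [].
exists W => //.
have nd : nowhere_dense_in Y (~` W `\` V).
  move=> U oU UY.
  have [[y [[Uy Vy] Yy]]|no] := pselect ((U `&` V `&` Y) !=set0).
    exists (U `&` V); split; first exact: openI.
    - by move=> t [].
    - by exists y.
    - by move=> t [[_ Vt] _] [].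
  exists U; split => // t [Ut Yt] [nW _]; apply: nW; exists U => //.
  by split => // z [Uz Yz] Vz; apply: no; exists z.
apply: meager_in_sub (meager_inU mV (nowhere_dense_in_meager nd)).
move=> y [Yy [[nE nW]|[Wy nnE]]].
  by have [Vy|nVy] := pselect (V y); [left; right|right].
left; left; split; first exact: contrapT.
by have [U [_ UV] Uy] := Wy; apply: UV.
Qed.

Lemma baire_property_bigcup Y (E : nat -> set T) :
  (forall n, baire_property_in Y (E n)) ->
  baire_property_in Y (\bigcup_n E n).
Proof.
move=> bE; have /choice[V VP] n : exists V, open V /\
    meager_in Y ((E n `\` V) `|` (V `\` E n)).
  by have [V ? ?] := bE n; exists V.
exists (\bigcup_n V n); first by apply: bigcup_open => n _; case: (VP n).
have m : meager_in Y (\bigcup_n ((E n `\` V n) `|` (V n `\` E n))).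
  by apply: meager_in_bigcup => [|n _]; [exact: countableP|case: (VP n)].
apply: meager_in_sub m => y [_ [[[n _ En] nV]|[[n _ Vn] nE]]]; exists n => //.
  by left; split => // Vn; apply: nV; exists n.
by right; split => // En; apply: nE; exists n.
Qed.

Lemma baire_property_sigma (Z : Type) (f : T -> Z) Y (H : set (set Z)) :
  (forall A, H A -> baire_property_in Y (f @^-1` A)) ->
  forall A, <<s H >> A -> baire_property_in Y (f @^-1` A).
Proof.
move=> bH; apply: (@smallest_sub _ _ _ [set A | baire_property_in Y (f @^-1` A)]) => //.
split.
- by rewrite /= preimage_set0; exact/baire_property_open/open0.
- by move=> A bA; rewrite /= setTD preimage_setC; exact: baire_propertyC.
- by move=> A bA; rewrite /= preimage_bigcup; exact: baire_property_bigcup.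
Qed.

(** Up to a meager set the complement of [E'] is an open [W]. On each basic set inside [W] the set
    [E'] is meager, hence so is [E], and countably many such sets cover [W]. *)
Lemma meager_in_setD (I : countType) (U : I -> set T) Y E E' :
  (forall V, open V -> family_open U V) ->
  baire_property_in Y E' ->
  (forall i, meager_in Y (U i `&` E') -> meager_in Y (U i `&` E)) ->
  meager_in Y (E `\` E').
Proof.
move=> Ub /baire_propertyC[W oW mW] EE'.
have m : meager_in Y (\bigcup_(i in [set i | U i `<=` W]) (U i `&` E)).
  apply: meager_in_bigcup => [|i iW]; first exact: countableP.
  apply: EE'; apply: meager_in_sub mW => y [_ [/iW Wy E'y]].
  by right; split => //; exact.
apply: meager_in_sub (meager_inU mW m) => y [Yy [Ey nE'y]].
have [Wy|nWy] := pselect (W y); last by left; left.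
by have [i Ui iW] := Ub W oW y Wy; right; exists i.
Qed.

End RelativeCategory.

(** The indices above some term of the sequence form a filter, to which completeness applies. *)
Lemma descending_point (I K T : Type) (B : I -> set T) (C : K -> I -> I -> Prop)
    (s : nat -> I) :
  cover_complete B C -> (forall m n, (m <= n)%N -> B (s n) `<=` B (s m)) ->
  (forall k i n, B (s n) `<=` B i -> exists2 j, C k i j &
     exists m, B (s m) `<=` B j) ->
  exists x, forall i, B i x <-> exists n, B (s n) `<=` B i.
Proof.
move=> [_ _ comp] desc cov.
have [||x xP] := comp [set i | exists n, B (s n) `<=` B i]; last first.
- by exists x => i; split => /xP.
- by move=> k i [n ni]; have [j Cj [m mj]] := cov k i n ni; exists j => //; exists m.
split.
- by exists (s 0%N); exists 0%N.
- by move=> i j [n ni] ij; exists n; exact: subset_trans ij.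
- move=> i j [n ni] [m mj]; exists (s (maxn n m)); first by exists (maxn n m).
  by move=> x Bx; split; [apply: ni|apply: mj];
     apply: desc Bx; [exact: leq_maxl|exact: leq_maxr].
Qed.

(** * Open quasi-Polish groupoids and their target fibers *)

Section Groupoid.
Variables (G0 G : topologicalType) (Gam : topGroupoid G0 G).
Hypothesis G_open : open_groupoid Gam.
Variable U : seq nat -> set G.
Hypotheses (U_presented : presented_basis U) (U_open : forall s, open (U s))
  (U_basis : forall V, open V -> family_open U V).

Local Notation src := (gsrc Gam).
Local Notation tgt := (gtgt Gam).
Local Notation mul := (gmul Gam).
Local Notation inv := (ginv Gam).
Local Notation idg := (gid Gam).

Definition target_fiber (x : G0) : set G := tgt @^-1` [set x].

Definition product_sub (V W Z : set G) : Prop :=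
  forall g h, V g -> W h -> src g = tgt h -> Z (mul g h).

Lemma gmul_nbhs g h Z : src g = tgt h -> open Z -> Z (mul g h) ->
  exists V W, [/\ open V, open W, V g, W h & product_sub V W Z].
Proof.
move=> gh oZ Zgh.
have /subspace_continuousP/(_ (g, h) gh) := @gmul_continuous _ _ Gam.
move=> /(_ Z (open_nbhs_nbhs (conj oZ Zgh))).
move=> [[V W] /= [nV nW] VWZ].
move: nV nW; rewrite !nbhsE => -[V' [oV' V'g] V'V] [W' [oW' W'h] W'W].
exists V', W'; split => // g' h' Vg' Wh' gh'.
apply: (VWZ (g', h')) => //=.
by split; [exact: V'V|exact: W'W].
Qed.

Lemma ginvK g h : src g = tgt h -> mul (inv g) (mul g h) = h.
Proof.
by move=> gh; rewrite gmulA ?gsrc_inv// gmul_invl gh gmul_idl.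
Qed.

Lemma ginvVK g h : tgt g = tgt h -> mul g (mul (inv g) h) = h.
Proof.
by move=> gh; rewrite gmulA ?gtgt_inv ?gsrc_inv// gmul_invr gh gmul_idl.
Qed.

Lemma ginv_mul g k : src g = tgt k -> inv (mul g k) = mul (inv k) (inv g).
Proof.
move=> gk; set h := mul (inv k) (inv g).
have e : src (inv k) = tgt (inv g) by rewrite gsrc_inv gtgt_inv.
have hx : src h = tgt (mul g k) by rewrite gsrc_mul// gsrc_inv gtgt_mul.
have hid : mul h (mul g k) = idg (src (mul g k)).
  rewrite /h -gmulA ?gsrc_inv ?gtgt_mul// ?ginvK// ?gmul_invl ?gsrc_mul//.
  by rewrite gtgt_inv.
rewrite -[h](@gmul_idr _ _ Gam) hx -gmul_invr gmulA ?gtgt_inv//.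
by rewrite hid -gtgt_inv gmul_idl.
Qed.

(** A base of [G0] is obtained from that of [G]: a basic neighborhood of the identity at [x], taken
    inside the preimage of [W], has its source image inside [W]. *)
Lemma src_basis W : open W -> family_open (fun v => src @` U v) W.
Proof.
move=> oW x Wx.
have oV : open (src @^-1` W).
  by apply: open_comp => // g _; exact: gsrc_continuous.
have Vx : (src @^-1` W) (idg x) by rewrite /= gsrc_id.
have [v Uv vW] := U_basis oV Vx.
exists v; first by exists (idg x) => //; rewrite gsrc_id.
by move=> _ [g Ug <-]; exact: vW.
Qed.

(** [gid] is continuous and injective, so [G0] inherits the T0 property of [G]. *)
Lemma src_separates : family_separates (fun v => src @` U v).
Proof.
move=> x y xy.
suff : idg x = idg y by move=> /(congr1 src); rewrite !gsrc_id.
have half x' y' i : (forall v, (src @` U v) x' -> (src @` U v) y') ->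
    U i (idg x') -> U i (idg y').
  move=> xy' Ux.
  have oV : open (idg @^-1` U i).
    by apply: open_comp => // z _; exact: gid_continuous.
  have [v Vx vU] := src_basis oV Ux.
  by apply: vU; exact: xy'.
apply: (basis_separates U_presented) => i.
by split; apply: half => v; apply xy.
Qed.

(** Basic sets meeting the fiber are shrunk so as to meet the coverings, to enter the target
    preimage of every basic neighborhood of [x], and to avoid each [F n] on the fiber. The resulting
    point is in the fiber and in no [F n]. *)
Lemma target_fiber_nonmeager x : ~ meager_in (target_fiber x) setT.
Proof.
move=> [F Fn /= YF].
have oT v : open (tgt @^-1` (src @` U v)).
  by apply: open_comp; [move=> z _; exact: gtgt_continuous|exact: G_open].
have [C CP] := basis_complete U_presented; have [Csub Ccov _] := CP.
pose Req (r : nat * seq nat + seq nat + nat) (i j : seq nat) : Prop :=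
  match r with
  | inl (inl (k, v)) => U i `<=` U v -> exists2 w, C k v w & U j `<=` U w
  | inl (inr v) => (src @` U v) x -> U j `<=` tgt @^-1` (src @` U v)
  | inr n => U j `&` target_fiber x `<=` ~` F n
  end.
have [||||s [Ds les Rs]] := @generic_sequence_countType _ _
    [set i | (U i `&` target_fiber x) !=set0] (fun i j => U i `<=` U j) Req.
- by move=> i y.
- by move=> i j k ij jk; exact: subset_trans jk.
- by exists [::]; exists (idg x); rewrite (basis_nil U_presented); split => //;
     rewrite /target_fiber /= gtgt_id.
- move=> r i [h [Uh Yh]].
  have refine (w : seq nat) : U w h ->
      [/\ (U (i ++ w) `&` target_fiber x) !=set0, U (i ++ w) `<=` U i
        & U (i ++ w) `<=` U w].
    move=> Uw; rewrite (basis_cat U_presented).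
    by split; [exists h|move=> y []..].
  have same : [/\ (U i `&` target_fiber x) !=set0 & U i `<=` U i].
    by split; [exists h|].
  case: r => [[[k v]|v]|n] /=.
  + have [iv|niv] := pselect (U i `<=` U v); last by exists i; case: same.
    have [w Cw Uw] := Ccov k v h (iv h Uh); have [? ? ?] := refine w Uw.
    by exists (i ++ w); split => // _; exists w.
  + have [xv|nxv] := pselect ((src @` U v) x); last by exists i; case: same.
    have hv : (tgt @^-1` (src @` U v)) h by rewrite /= (Yh : tgt h = x).
    have [w Uw wv] := U_basis (oT v) hv.
    have [? ? ww] := refine w Uw; exists (i ++ w); split => // _.
    exact: subset_trans wv.
  + have [|W [oW Wi [z [Wz Yz]] WF]] := Fn n (U i) (U_open i); first by exists h.
    have [w Uw wW] := U_basis oW Wz.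
    exists w; split; [by exists z|exact: subset_trans Wi|].
    by move=> y [/wW Wy Yy]; exact: WF.
have [||g gP] := descending_point (s := s) CP.
- by [].
- move=> k v n nv; have [m nm Rm] := Rs (inl (inl (k, v))) n.
  have [w Cw mw] := Rm (subset_trans (les _ _ nm) nv).
  by exists w => //; exists m.+1.
have Us n : U (s n) g by apply/gP; exists n.
have Yg : target_fiber x g.
  (* Every basic neighborhood of [g] contains a term of the sequence, which meets the fiber; this
     gives one direction. The other was imposed as a requirement. *)
  apply: src_separates => v; split.
    move=> gv.
    have [w /gP[n nw] wv] := U_basis (oT v) gv.
    by have [h [Uh Yh]] := Ds n; have := wv h (nw h Uh); rewrite /= (Yh : tgt h = x).
  move=> xv; have [n _ /= /(_ xv) nv] := Rs (inl (inr v)) 0%N.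
  exact: (nv g).
have [|n _ Fg] := YF g; first by split.
have [m _ mF] := Rs (inr n) 0%N.
exact: (mF g).
Qed.

(** * Vaught transforms for a Borel action *)

Section Action.
Variables (X : Type) (BX : set (set X)) (p : X -> G0) (act : G -> X -> X).
Hypothesis X_gspace : borel_gspace Gam p act BX.

Lemma act_inv g a : src g = p a -> act (inv g) (act g a) = a.
Proof.
move=> ga; rewrite -(gspace_actA X_gspace) ?gsrc_inv//.
by rewrite gmul_invl ga (gspace_act_id X_gspace).
Qed.

Lemma act_invr g a : tgt g = p a -> act g (act (inv g) a) = a.
Proof.
move=> ga; rewrite -(gspace_actA X_gspace) ?gsrc_inv// ?gtgt_inv//.
by rewrite gmul_invr ga (gspace_act_id X_gspace).
Qed.

Lemma anchor_inv g a : tgt g = p a -> p (act (inv g) a) = src g.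
Proof. by move=> ga; rewrite (gspace_anchor_act X_gspace) ?gtgt_inv ?gsrc_inv. Qed.

Lemma translateE g A a : tgt g = p a ->
  translate Gam p act g A a <-> A (act (inv g) a).
Proof.
move=> ga; split => [[b [Ab gb] <-]|Aa]; first by rewrite act_inv.
exists (act (inv g) a); last exact: act_invr.
by split => //; rewrite anchor_inv.
Qed.

Local Notation vaught := (vaught Gam p act).

Lemma vaughtP V A a : vaught V A a <->
  ~ meager_in (target_fiber (p a)) [set g | V g /\ A (act (inv g) a)].
Proof.
rewrite /Defs.vaught /= nonmeager_inP; apply: not_iff_compat.
by split; apply: meager_in_sub => g [/= ga] [Vg /(translateE _ ga)].
Qed.

(** A nonmeager set covered by countably many sets meets one of them in a nonmeager set. With a
    one-element index type this is monotonicity of the transform. *)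
Lemma vaught_cover (J : Type) (D : set J) (V : J -> set G) (A : J -> set X)
    V0 A0 a :
  countable D -> vaught V0 A0 a ->
  (forall g, tgt g = p a -> V0 g -> A0 (act (inv g) a) ->
     exists2 j, D j & V j g /\ A j (act (inv g) a)) ->
  exists2 j, D j & vaught (V j) (A j) a.
Proof.
move=> cD /vaughtP nm cov; apply: contrapT => no; apply: nm.
have m : meager_in (target_fiber (p a))
    (\bigcup_(j in D) [set g | V j g /\ A j (act (inv g) a)]).
  apply: meager_in_bigcup => // j Dj; apply: contrapT => nm; apply: no.
  by exists j => //; apply/vaughtP.
by apply: meager_in_sub m => g [ga [Vg Ag]]; exact: cov.
Qed.

Lemma vaught_point V A a : vaught V A a ->
  exists g, [/\ tgt g = p a, V g & A (act (inv g) a)].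
Proof.
move=> /vaughtP nm; apply: contrapT => no; apply: nm.
apply: meager_in_sub (meager_in0 _) => g [ga [Vg Ag]].
by apply: no; exists g.
Qed.

Lemma vaughtTT a : vaught setT setT a.
Proof.
apply/vaughtP => m; apply: (@target_fiber_nonmeager (p a)).
by apply: meager_in_sub m.
Qed.

(** Left multiplication by [g] is a homeomorphism between the target fibers over [src g] and
    [tgt g]. *)
Lemma left_translate_meager g E :
  meager_in (target_fiber (tgt g)) E <->
  meager_in (target_fiber (src g)) (mul g @^-1` E).
Proof.
have tr h E' : meager_in (target_fiber (tgt h)) E' ->
    meager_in (target_fiber (src h)) (mul h @^-1` E').
  apply: (@meager_in_homeo _ (mul h) (mul (inv h))).
  - by move=> k hk; rewrite /target_fiber /= gtgt_mul.
  - by move=> k hk; rewrite /target_fiber /= gtgt_mul ?gtgt_inv ?gsrc_inv.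
  - by move=> k hk; rewrite ginvVK.
  - by move=> k hk; rewrite ginvK.
  - move=> k V hk oV Vk; have [V1 [W [oV1 oW V1h Wk VW]]] := gmul_nbhs (esym hk) oV Vk.
    by exists W; split => // k' [Wk' hk']; apply: VW.
  - move=> k V hk oV Vk.
    have hk1 : src (inv h) = tgt k by rewrite gsrc_inv hk.
    have [V1 [W [oV1 oW V1h Wk VW]]] := gmul_nbhs hk1 oV Vk.
    by exists W; split => // k' [Wk' hk']; apply: VW => //; rewrite gsrc_inv hk'.
split; first exact: tr.
move=> m; have := tr (inv g) (mul g @^-1` E); rewrite gtgt_inv gsrc_inv => /(_ m).
by apply: meager_in_sub => h [hg Eh] /=; rewrite ginvVK.
Qed.

(** Writing the elements of the fiber over [tgt g] as [mul g k], the inverse of [mul g k] sends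
    [act g a] where [inv k] sends [a]. By continuity [mul g k] is in [V] iff some basic [u], [w]
    around [g], [k] have product inside [V]; there are countably many such pairs, so one of them
    keeps a nonmeager set. *)
Lemma vaught_act V A g a : open V -> src g = p a ->
  vaught V A (act g a) <->
  exists u w, [/\ U u g, product_sub (U u) (U w) V & vaught (U w) A a].
Proof.
move=> oV ga; have pga := gspace_anchor_act X_gspace ga.
have actE k : tgt k = src g -> act (inv (mul g k)) (act g a) = act (inv k) a.
  move=> kg; have gk : src g = tgt k by [].
  rewrite ginv_mul// (gspace_actA X_gspace) ?gsrc_inv ?gtgt_inv ?pga//.
  by rewrite act_inv.
split => [/vaughtP nm|[u [w [Uug uwV /vaughtP nm]]]].
  have [[u w] [Uug uwV] va] : exists2 uw : seq nat * seq nat,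
      U uw.1 g /\ product_sub (U uw.1) (U uw.2) V & vaught (U uw.2) A a.
    apply: contrapT => no; apply: nm; rewrite pga; apply/left_translate_meager.
    rewrite ga.
    have m : meager_in (target_fiber (p a)) (\bigcup_(uw in [set uw |
        U uw.1 g /\ product_sub (U uw.1) (U uw.2) V])
          [set k | U uw.2 k /\ A (act (inv k) a)]).
      apply: meager_in_bigcup => [|uw uwP]; first exact: countableP.
      by apply: contrapT => nm; apply: no; exists uw => //; apply/vaughtP.
    apply: meager_in_sub m => k [ka [/= Vgk]].
    have kg : tgt k = src g by rewrite ga.
    rewrite actE// => Ak.
    have [V1 [W [oV1 oW V1g Wk VW]]] := gmul_nbhs (esym kg) oV Vgk.
    have [u Uu uV1] := U_basis oV1 V1g; have [w Uw wW] := U_basis oW Wk.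
    exists (u, w) => //=; split => // g' h' /uV1 Vg' /wW Wh'.
    exact: VW.
  by exists u, w.
apply/vaughtP => m; apply: nm; move: m; rewrite pga => /left_translate_meager.
rewrite ga; apply: meager_in_sub => k [ka [Uk Ak]] /=.
have kg : tgt k = src g by rewrite ga.
by split; [exact: uwV|rewrite actE].
Qed.

(** On the fiber the set is the preimage of a product Borel set under the map sending [g] to
    [(inv g, a)]. A rectangle pulls back to the empty set or to the preimage of a Borel set under
    the continuous [inv]. *)
Lemma orbit_map_baire Y A a : BX A -> Y `<=` target_fiber (p a) ->
  baire_property_in Y [set g | A (act (inv g) a)].
Proof.
move=> BA Ya; have [W WP AW] := gspace_act_borel X_gspace BA.
apply: (@baire_property_ext _ _ ((fun g => (inv g, a)) @^-1` W)).
  move=> g Yg; have ga : src (inv g) = p a by rewrite gsrc_inv (Ya g Yg).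
  have fp : fiber_prod Gam p setT setT (inv g, a) by split.
  split => [Wg|Ag].
    by have [] : act_preimage Gam p act A (inv g, a) by rewrite AW.
  by have : act_preimage Gam p act A (inv g, a) by []; rewrite AW => -[].
apply: baire_property_sigma WP => _ [V VB [B BB <-]].
have [Ba|nBa] := pselect (B a); last first.
  apply: baire_property_ext (baire_property_open Y open0).
  by move=> g Yg; split => // -[].
apply: (@baire_property_ext _ _ (inv @^-1` V)); first by move=> g Yg; split => // -[].
apply: baire_property_sigma VB => Z oZ; apply: baire_property_open.
by apply: open_comp => // g _; exact: ginv_continuous.
Qed.

End Action.
End Groupoid.

(** * The topology generated by Vaught transforms *)

Section VaughtTopology.
Variables (G0 G : topologicalType) (Gam : topGroupoid G0 G).
Hypothesis G_open : open_groupoid Gam.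
Variable U : seq nat -> set G.
Hypotheses (U_presented : presented_basis U) (U_open : forall s, open (U s))
  (U_basis : forall V, open V -> family_open U V).
Variables (X : Type) (BX : set (set X)) (p : X -> G0) (act : G -> X -> X).
Hypothesis X_gspace : borel_gspace Gam p act BX.

Local Notation src := (gsrc Gam).
Local Notation tgt := (gtgt Gam).
Local Notation inv := (ginv Gam).
Local Notation vaught := (vaught Gam p act).

Variables (IX KX : countType) (A : IX -> set X) (CX : KX -> IX -> IX -> Prop).
Hypotheses (A_complete : cover_complete A CX) (A_separates : family_separates A)
  (A_borel : forall a, BX (A a))
  (A_total : forall x, exists a, A a x)
  (A_meet : forall a b, family_open A (A a `&` A b))
  (A_anchor : forall v, family_open A (p @^-1` (src @` U v)))
  (A_vaught : forall w b, family_open A (vaught (U w) (A b))).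

Local Notation I := (seq nat * IX)%type.

Definition vaught_base (i : I) : set X := vaught (U i.1) (A i.2).

Lemma vaught_base_open (V : set G) (B : set X) : open V -> family_open A B ->
  family_open vaught_base (vaught V B).
Proof.
move=> oV oB x VBx.
have [|||i [iV iB] xi] := @vaught_cover _ _ _ _ _ _ _ X_gspace I
  [set i | U i.1 `<=` V /\ A i.2 `<=` B] (U \o fst) (A \o snd) V B x.
- exact: countableP.
- exact: VBx.
- move=> g gx Vg Bg; have [u Uu uV] := U_basis oV Vg; have [a Aa aB] := oB _ Bg.
  by exists (u, a).
exists i => // y; move=> yi.
have [|||_ _ //] := @vaught_cover _ _ _ _ _ _ _ X_gspace unit setT
  (fun=> V) (fun=> B) (U i.1) (A i.2) y.
- exact: countableP.
- exact: yi.
- by move=> g gy Ug Ag; exists tt => //; split; [exact: iV|exact: iB].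
Qed.

Lemma vaught_base_total x : exists i, vaught_base i x.
Proof.
have oT : family_open A setT by move=> y _; have [a Aa] := A_total y; exists a.
have xT : vaught setT setT x.
  exact: (vaughtTT G_open U_presented U_open U_basis X_gspace).
by have [i xi _] := vaught_base_open openT oT xT; exists i.
Qed.

(** The preimage of [V] under [p] is the Vaught transform of the whole space by the target preimage
    of [V]. *)
Lemma anchor_vaught_base_open V : open V ->
  family_open vaught_base (p @^-1` V).
Proof.
move=> oV x Vx.
have oT : family_open A setT by move=> y _; have [a Aa] := A_total y; exists a.
have oTV : open (tgt @^-1` V).
  by apply: open_comp => // g _; exact: gtgt_continuous.
have xT : vaught (tgt @^-1` V) setT x.
  have [|||_ _ //] := @vaught_cover _ _ _ _ _ _ _ X_gspace unit setT
    (fun=> tgt @^-1` V) (fun=> setT) setT setT x.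
  - exact: countableP.
  - exact: (vaughtTT G_open U_presented U_open U_basis X_gspace).
  - by move=> g gx _ _; exists tt => //; split => //=; rewrite gx.
have [i xi iV] := vaught_base_open oTV oT xT; exists i => // y /iV.
by move=> /(vaught_point X_gspace)[g [gy /= + _]]; rewrite gy.
Qed.

(** First [p x = p y]. For each [a], the sets of [g] moving [x], respectively [y], into [A a] by
    [inv g] differ by a meager set, so some [g] avoids all differences. Then [inv g] sends [x] and
    [y] to the same point, and acting by [g] gives [x = y]. *)
Lemma vaught_base_separates : family_separates vaught_base.
Proof.
move=> x y xy.
have pxy : p x = p y.
  apply: (@src_separates _ _ Gam _ U_presented U_open U_basis) => v.
  have half z z' : (forall i, vaught_base i z -> vaught_base i z') ->
      (src @` U v) (p z) -> (src @` U v) (p z').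
    move=> zz' pz; have [i zi iv] := anchor_vaught_base_open (G_open (U_open v)) pz.
    exact/iv/zz'.
  by split; apply: half => i /xy.
pose Y := target_fiber Gam (p x); pose E z a := [set g | A a (act (inv g) z)].
have diff z z' a : p z = p x -> p z' = p x ->
    (forall i, vaught_base i z -> vaught_base i z') ->
    meager_in Y (E z a `\` E z' a).
  move=> pz pz' zz'; apply: (meager_in_setD U_basis).
    by apply: (orbit_map_baire X_gspace) => //; rewrite pz'.
  move=> u m'; apply: contrapT => m.
  have /zz'/(vaughtP X_gspace) : vaught_base (u, a) z.
    by apply/(vaughtP X_gspace); rewrite pz.
  by rewrite pz'; apply.
have m : meager_in Y (\bigcup_a ((E x a `\` E y a) `|` (E y a `\` E x a))).
  apply: meager_in_bigcup => [|a _]; first exact: countableP.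
  by apply: meager_inU; apply: diff => // i /xy.
have [g [Yg gxy]] : exists g, Y g /\ forall a, E x a g <-> E y a g.
  apply: contrapT => no.
  apply: (@target_fiber_nonmeager _ _ Gam G_open U U_presented U_open U_basis (p x)).
  apply: meager_in_sub m => g [Yg _]; apply: contrapT => ng; apply: no.
  exists g; split => // a; split => Eg; apply: contrapT => nE; apply: ng.
    by exists a => //; left.
  by exists a => //; right.
have e : act (inv g) x = act (inv g) y by apply: A_separates => a; exact: gxy.
rewrite -(act_invr X_gspace (g := g) (a := x))// e.
by rewrite (act_invr X_gspace)// -pxy.
Qed.

Local Notation K := (nat * seq nat + KX * IX + seq nat + seq nat + I)%type.

Variable CG : nat -> seq nat -> seq nat -> Prop.
Hypothesis CG_complete : cover_complete U CG.

Definition refinement_premise (r : K) : seq I :=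
  if r is inr vb then [:: vb] else [::].

(* A decreasing sequence of pairs (U i.1, A i.2) meeting all these refinements
   converges to a point (g, y) with src g = p y, and the last one makes
   act g y belong to U vb.1 * A vb.2. *)
Definition refinement (r : K) (i j : I) : Prop :=
  match r with
  | inl (inl (inl (inl (k, v)))) =>
      U i.1 `<=` U v -> exists2 w, CG k v w & U j.1 `<=` U w
  | inl (inl (inl (inr (k, b)))) =>
      A i.2 `<=` A b -> exists2 c, CX k b c & A j.2 `<=` A c
  | inl (inl (inr v)) =>
      U i.1 `<=` src @^-1` (src @` U v) -> A j.2 `<=` p @^-1` (src @` U v)
  | inl (inr v) =>
      A i.2 `<=` p @^-1` (src @` U v) -> U j.1 `<=` src @^-1` (src @` U v)
  | inr vb => exists2 w, product_sub Gam (U j.1) (U w) (U vb.1) &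
      A j.2 `<=` vaught (U w) (A vb.2)
  end.

Definition index_le (j i : I) : Prop := U j.1 `<=` U i.1 /\ A j.2 `<=` A i.2.

(** By [vaught_cover] it suffices to refine around each pair [(g, y)] with [act g y = x].
    Completeness, continuity of the source and anchor, or, for the last kind, the key formula
    provide the smaller neighborhoods. *)
Lemma refinement_valid r i x :
  finite_meet vaught_base (refinement_premise r) x -> vaught_base i x ->
  exists2 j, index_le j i /\ refinement r i j & vaught_base j x.
Proof.
move=> prex xi.
apply: (@vaught_cover _ _ _ _ _ _ _ X_gspace I _ (U \o fst) (A \o snd) _ _ x _ xi).
  exact: countableP.
move=> g gx Ug Ay; set y := act (inv g) x in Ay *.
have gy : src g = p y by rewrite (anchor_inv X_gspace gx).
have oS v : open (src @^-1` (src @` U v)).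
  by apply: open_comp; [move=> h _; exact: gsrc_continuous|exact: G_open].
have refU w : U w g -> [/\ U (i.1 ++ w) g, U (i.1 ++ w) `<=` U i.1
    & U (i.1 ++ w) `<=` U w].
  by move=> Uw; rewrite (basis_cat U_presented); split => // h [].
have refA B : family_open A B -> B y -> exists c, [/\ A c y, A c `<=` A i.2
    & A c `<=` B].
  move=> oB /oB[b Ab bB]; have [c Ac cib] := A_meet (conj Ay Ab).
  by exists c; split => // z /cib[] // _ /bB.
have ii : index_le i i by split.
case: r prex => [[[[[k v]|[k b]]|v]|v]|vb] /= prex.
- have [iv|niv] := pselect (U i.1 `<=` U v);
    last by exists i => //; split.
  have [_ /(_ k v g (iv g Ug))[w Cw Uw] _] := CG_complete.
  have [? ? ?] := refU w Uw; exists (i.1 ++ w, i.2) => //.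
  by split; [split|move=> _; exists w].
- have [ib|nib] := pselect (A i.2 `<=` A b);
    last by exists i => //; split.
  have [_ /(_ k b y (ib y Ay))[c Cc Ac] _] := A_complete.
  have oc : family_open A (A c) by move=> z Az; exists c.
  have [c' [? ? ?]] := refA _ oc Ac; exists (i.1, c') => //.
  by split; [split|move=> _; exists c].
- have [iv|niv] := pselect (U i.1 `<=` src @^-1` (src @` U v));
    last by exists i => //; split.
  have [|c [? ? ?]] := refA _ (@A_anchor v).
    by rewrite /= -gy; exact: iv.
  by exists (i.1, c) => //; split; [split|].
- have [iv|niv] := pselect (A i.2 `<=` p @^-1` (src @` U v));
    last by exists i => //; split.
  have gv : (src @^-1` (src @` U v)) g by rewrite /= gy; exact: iv.
  have [w Uw wv] := U_basis (oS v) gv.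
  have [? ? ww] := refU w Uw; exists (i.1 ++ w, i.2) => //.
  by split; [split|move=> _; exact: subset_trans wv].
- have xvb : vaught (U vb.1) (A vb.2) (act g y).
    by rewrite (act_invr X_gspace gx); apply: prex; rewrite mem_head.
  have [u [w [Uu uwv yw]]] :=
    (vaught_act U_basis X_gspace _ (U_open vb.1) gy).1 xvb.
  have [c [? ? cw]] := refA _ (@A_vaught w vb.2) yw.
  have [? ? uu] := refU u Uu; exists (i.1 ++ u, c) => //.
  split; first by split.
  by exists w => // h k /uu Uh Uk; exact: uwv.
Qed.

(** The axioms say, in this order, that a description is inhabited, closed upwards, and meets every
    refinement of its members. *)
Definition vaught_axiom_premise (k : unit + I * I + K * I) : seq I :=
  match k with
  | inl (inl _) => [::]
  | inl (inr (i, _)) => [:: i]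
  | inr (r, i) => i :: refinement_premise r
  end.

(** In the second kind the conclusion is all of [I] when the inclusion fails, so that the axiom is
    then trivial and all pairs [(i, j)] can be allowed. *)
Definition vaught_axiom_conclusion (k : unit + I * I + K * I) : set I :=
  match k with
  | inl (inl _) => setT
  | inl (inr (i, j)) => [set l | vaught_base i `<=` vaught_base j -> l = j]
  | inr (r, i) => [set j | index_le j i /\ refinement r i j]
  end.

Lemma vaught_axioms_valid k x :
  finite_meet vaught_base (vaught_axiom_premise k) x ->
  exists2 i, vaught_axiom_conclusion k i & vaught_base i x.
Proof.
case: k => [[[]|[i j]]|[r i]] /= Px.
- by have [i xi] := vaught_base_total x; exists i.
- have [ij|nij] := pselect (vaught_base i `<=` vaught_base j).
    by exists j => //; apply: ij; apply: Px; rewrite mem_head.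
  by exists i => //; apply: Px; rewrite mem_head.
- apply: refinement_valid; last by apply: Px; rewrite mem_head.
  by move=> j jr; apply: Px; rewrite inE jr orbT.
Qed.

Lemma vaught_axioms_realized (phi : set I) :
  (forall k, (forall i, i \in vaught_axiom_premise k -> phi i) ->
     exists2 i, vaught_axiom_conclusion k i & phi i) ->
  exists x, forall i, phi i <-> vaught_base i x.
Proof.
move=> ax.
have phi_mono i j : phi i -> vaught_base i `<=` vaught_base j -> phi j.
  move=> phii ij; have [|l /= /(_ ij)-> //] := ax (inl (inr (i, j))).
  by move=> l; rewrite inE => /eqP->.
have [||||s [phis les Rs]] := @generic_sequence_countType _ _ phi index_le
  (fun r i j => (forall l, l \in refinement_premise r -> phi l) ->
     refinement r i j).
- by move=> i; split.
- by move=> i j k [? ?] [? ?]; split; [apply: subset_trans|apply: subset_trans];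
     eassumption.
- by have [//|i _ phii] := ax (inl (inl tt)); exists i.
- move=> r i phii.
  have [pr|npr] := pselect (forall l, l \in refinement_premise r -> phi l).
    have [|j [ji rj] phij] := ax (inr (r, i)); last by exists j.
    by move=> l; rewrite inE => /orP[/eqP->//|/pr].
  by exists i; split => //; split.
have [||g gP] := descending_point (s := fst \o s) CG_complete.
- by move=> m n mn; case: (les _ _ mn).
- move=> k v n nv; have [m nm Rm] := Rs (inl (inl (inl (inl (k, v))))) n.
  have [//||w Cw mw] := Rm; last by exists w => //; exists m.+1.
  by apply: subset_trans nv; case: (les _ _ nm).
have [||y yP] := descending_point (s := snd \o s) A_complete.
- by move=> m n mn; case: (les _ _ mn).
- move=> k b n nb; have [m nm Rm] := Rs (inl (inl (inl (inr (k, b))))) n.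
  have [//||c Cc mc] := Rm; last by exists c => //; exists m.+1.
  by apply: subset_trans nb; case: (les _ _ nm).
have Us n : U (s n).1 g by apply/gP; exists n.
have As n : A (s n).2 y by apply/yP; exists n.
have oS v : open (src @^-1` (src @` U v)).
  by apply: open_comp; [move=> h _; exact: gsrc_continuous|exact: G_open].
have gy : src g = p y.
  (* The two middle kinds of refinement transfer basic neighborhoods between [src g] and [p y]. *)
  apply: (@src_separates _ _ Gam _ U_presented U_open U_basis) => v; split => [gv|yv].
    have [u /gP[n nu] uv] := U_basis (oS v) gv.
    have [m nm Rm] := Rs (inl (inl (inr v))) n.
    apply: Rm (As m.+1) => //.
    apply: subset_trans uv; apply: subset_trans nu.
    by case: (les _ _ nm).
  have [a /yP[n na] av] := @A_anchor v y yv.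
  have [m nm Rm] := Rs (inl (inr v)) n.
  apply: Rm (Us m.+1) => //.
  apply: subset_trans av; apply: subset_trans na.
  by case: (les _ _ nm).
exists (act g y) => -[v b]; split => [phiv|].
  have [m _ Rm] := Rs (inr (v, b)) 0%N.
  have [|w uwv mw] := Rm; first by move=> l; rewrite inE => /eqP->.
  apply/(vaught_act U_basis X_gspace _ (U_open v) gy).
  by exists (s m.+1).1, w; split => //; exact: mw.
move=> /(vaught_act U_basis X_gspace _ (U_open v) gy)[u [w [Uu uwv yw]]].
have [c /yP[n nc] cw] := A_vaught yw.
have /gP[m mu] := Uu.
(* At a late stage the pair lies inside [U u] and [A c]. The key formula, applied at every point of
   its transform, puts that transform inside the one of [(v, b)], and [phi] is closed upwards. *)
apply: (phi_mono (s (maxn n m))) => // x /(vaught_point X_gspace)[h [hx Uh Ah]].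
have [mh _] := les _ _ (leq_maxr n m); have [_ nh] := les _ _ (leq_maxl n m).
have hy : src h = p (act (inv h) x) by rewrite (anchor_inv X_gspace hx).
rewrite -(act_invr X_gspace hx); apply/(vaught_act U_basis X_gspace _ (U_open v) hy).
by exists u, w; split => //; [exact/mu/mh|exact/cw/nc/nh].
Qed.

Lemma vaught_topology_quasi_polish :
  quasi_polish (generated_topology vaught_base).
Proof.
exact: (countably_axiomatized_quasi_polish vaught_axioms_valid
  vaught_base_separates vaught_axioms_realized).
Qed.

(** For a subbasic set the key formula directly yields the neighborhoods [U u] of [g] and
    [vaught_base (w, i.2)] of [a]; finite meets follow by induction. *)
Lemma vaught_topology_act_continuous :
  act_continuous Gam p act (generated_topology vaught_base).
Proof.
move=> V oV g a ga Va.
have [s sga sV] := oV _ Va.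
have [W [Z [oW oZ Wg Za WZ]]] : exists W Z, [/\ open W,
    generated_topology vaught_base Z, W g, Z a
    & fiber_prod Gam p W Z `<=` act_preimage Gam p act (finite_meet vaught_base s)].
  elim: s sga {sV} => [_|i s IH sga].
    exists setT, setT; split => //; first exact: openT.
    exact: generated_topologyT.
  move: sga; rewrite -cat1s finite_meet_cat finite_meet1 => -[iga sga].
  have [W [Z [oW oZ Wg Za WZ]]] := IH sga.
  have [u [w [Uu uwv aw]]] := (vaught_act U_basis X_gspace _ (U_open i.1) ga).1 iga.
  exists (W `&` U u), (Z `&` vaught_base (w, i.2)); split => //.
  - exact: openI.
  - by apply: generated_topologyI => //; exact: generated_topology_base.
  - move=> [h b] [/= [Wh Uh] [Zb bw] hb]; split => //.
    split => /=; last by have [] := WZ (h, b) (And3 Wh Zb hb).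
    apply/(vaught_act U_basis X_gspace _ (U_open i.1) hb).
    by exists u, w.
exists W, Z; split => // hb hbP; have [? ?] := WZ hb hbP; split => //.
exact: sV.
Qed.

End VaughtTopology.

(** * Topological realizations inside the compatible family *)

Lemma generated_topology_sigma (I : countType) (X : Type) (B : I -> set X)
    (S : set (set X)) :
  sigma_topology S -> (forall i, S (B i)) -> generated_topology B `<=` S.
Proof.
move=> Ss SB V oV.
have SI s : S (finite_meet B s).
  elim: s => [|i s IH].
    suff -> : finite_meet B [::] = setT by exact: sigma_topologyT.
    by apply/seteqP; split.
  by rewrite -cat1s finite_meet_cat finite_meet1; exact: sigma_topologyI.
have -> : V = \bigcup_(s in [set s | finite_meet B s `<=` V]) finite_meet B s.
  apply/seteqP; split => [x Vx|x [s sV sx]]; last exact: sV.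
  by have [s sx sV] := oV x Vx; exists s.
apply: (sigma_topology_bigcup Ss).
by apply: countable_unions_index => //; exact: countableP.
Qed.

Section Realization.
Variables (G0 G : topologicalType) (Gam : topGroupoid G0 G).
Hypotheses (G_qp : quasi_polish_groupoid Gam) (G_open : open_groupoid Gam).
Variables (X : Type) (BX : set (set X)) (p : X -> G0) (act : G -> X -> X).
Hypothesis X_gspace : borel_gspace Gam p act BX.
Variable S : set (set X).
Hypotheses (S_borel : S `<=` BX) (S_sigma : sigma_topology S)
  (S_compat : compatible S)
  (S_anchor : forall V : set G0, open V -> S (p @^-1` V))
  (S_vaught : vaught_unions Gam p act S `<=` S).

Local Notation src := (gsrc Gam).
Local Notation vaught := (vaught Gam p act).

Lemma vaught_unions_vaught V B : open V -> S B ->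
  vaught_unions Gam p act S (vaught V B).
Proof.
move=> oV SB; exists [set vaught V B]; split; first exact: countable1.
  by move=> _ ->; exists V => //; exists B.
by rewrite bigcup_set1.
Qed.

(** For [a] in [A], every [g] in the fiber gives a pair [(g, act (inv g) a)] in the preimage, so the
    pieces cover the whole fiber and, this being nonmeager, one piece is nonmeager. Conversely a
    single such [g] brings [a] back into [A]. *)
Lemma vaught_unions_cover (J : Type) (D : set J) (V : J -> set G)
    (B : J -> set X) A :
  countable D -> (forall j, D j -> open (V j)) -> (forall j, D j -> S (B j)) ->
  act_preimage Gam p act A = \bigcup_(j in D) fiber_prod Gam p (V j) (B j) ->
  vaught_unions Gam p act S A.
Proof.
move=> cD oV SB AE.
have [U [Up Uo Ub]] := quasi_polish_basis G_qp.
have -> : A = \bigcup_(j in D) vaught (V j) (B j).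
  apply/seteqP; split => [a Aa|a [j Dj /(vaught_point X_gspace)[g [ga Vg Bg]]]].
    have aT : vaught setT setT a by exact: (vaughtTT G_open Up Uo Ub X_gspace).
    have [g ga _ _|j Dj aj] := vaught_cover X_gspace cD (V := V) (A := B) aT;
      last by exists j.
    have gy := esym (anchor_inv X_gspace ga).
    have : act_preimage Gam p act A (g, act (ginv Gam g) a).
      by split; [split|rewrite /= (act_invr X_gspace)].
    by rewrite AE => -[j Dj [/= Vg Bg _]]; exists j.
  have gy := esym (anchor_inv X_gspace ga).
  have : act_preimage Gam p act A (g, act (ginv Gam g) a).
    by rewrite AE; exists j.
  by move=> [_ /=]; rewrite (act_invr X_gspace).
apply: countable_unions_index => // j Dj.
by exists (V j); [exact: oV|exists (B j) => //; exact: SB].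
Qed.

Lemma fiber_tensor_vaught_unions A :
  fiber_tensor Gam p (@open G) S (act_preimage Gam p act A) ->
  vaught_unions Gam p act S A.
Proof.
move=> [C [cC CS CE]].
have /choice[f fP] D : exists VB : set G * set X, C D ->
    [/\ open VB.1, S VB.2 & D = fiber_prod Gam p VB.1 VB.2].
  have [CD|nCD] := pselect (C D); last by exists (setT, setT).
  by have [V oV [B SB <-]] := CS D CD; exists (V, B).
apply: (@vaught_unions_cover _ C (fst \o f) (snd \o f)) => //.
- by move=> D /fP[].
- by move=> D /fP[].
- rewrite CE; apply/seteqP.
  by split => ga [D CD Dga]; exists D => //; have [_ _ DE] := fP D CD;
     [rewrite /= -DE|rewrite DE].
Qed.

Lemma vaught_unions_fiber_tensor A : vaught_unions Gam p act S A ->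
  fiber_tensor Gam p (@open G) (vaught_unions Gam p act S)
    (act_preimage Gam p act A).
Proof.
move=> [C [cC CS AE]].
have [U [Up Uo Ub]] := quasi_polish_basis G_qp.
have /choice[f fP] D : exists VB : set G * set X, C D ->
    [/\ open VB.1, S VB.2 & D = vaught VB.1 VB.2].
  have [CD|nCD] := pselect (C D); last by exists (setT, setT).
  by have [V oV [B SB <-]] := CS D CD; exists (V, B).
pose J := [set j : set X * (seq nat * seq nat) |
  C j.1 /\ product_sub Gam (U j.2.1) (U j.2.2) (f j.1).1].
have -> : act_preimage Gam p act A = \bigcup_(j in J)
    fiber_prod Gam p (U j.2.1) (vaught (U j.2.2) (f j.1).2).
  apply/seteqP; split => [[g a] [[_ _ /= ga]]|[g a] [[D [u w]] [/= CD uw]]].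
    rewrite /= AE => -[D CD Dga]; have [oV SB DE] := fP D CD.
    move: Dga; rewrite DE => /(vaught_act Ub X_gspace _ oV ga)[u [w [Uu uw aw]]].
    by exists (D, (u, w)).
  move=> [/= Ug aw ga]; split; first by split.
  rewrite /= AE; exists D => //; have [oV SB ->] := fP D CD.
  by apply/(vaught_act Ub X_gspace _ oV ga); exists u, w.
apply: countable_unions_index => [|[D [u w]] [/= CD _]].
  apply: (@sub_countable _ _ _ (C `*` setT)).
    by apply: subset_card_le => j [].
  by apply: countableX => //; exact: countableP.
have [oV SB _] := fP D CD; exists (U u); first exact: Uo.
by exists (vaught (U w) (f D).2) => //; apply: vaught_unions_vaught.
Qed.

Lemma realization_fiber_tensor O A : topological_realization Gam p act S O ->
  O A -> fiber_tensor Gam p (@open G) S (act_preimage Gam p act A).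
Proof.
move=> [[[B [cB BO Bb]] _] OS _ Oact] OA.
have [U [Up Uo Ub]] := quasi_polish_basis G_qp.
pose J := [set j : set X * seq nat |
  B j.1 /\ fiber_prod Gam p (U j.2) j.1 `<=` act_preimage Gam p act A].
have -> : act_preimage Gam p act A = \bigcup_(j in J)
    fiber_prod Gam p (U j.2) j.1.
  apply/seteqP; split => [[g a] [[_ _ /= ga] /= Aga]|ga [j [_ jA] /jA//]].
  have [V [W [oV OW Vg Wa VW]]] := Oact A OA g a ga Aga.
  have [u Uu uV] := Ub V oV g Vg; have [W' BW' [W'a W'W]] := Bb W a OW Wa.
  exists (W', u) => //; split => // -[h b] [/= Uh Wb hb].
  by apply: VW; split; [exact: uV|exact: W'W|].
apply: countable_unions_index => [|[W u] [/= BW _]].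
  apply: (@sub_countable _ _ _ (B `*` setT)).
    by apply: subset_card_le => j [].
  by apply: countableX => //; exact: countableP.
exists (U u); first exact: Uo.
by exists W => //; apply: OS; exact: BO.
Qed.

(** [E] collects the sets whose transforms must become open; it is placed in the first topology of
    the increasing sequence. *)
Lemma realization_exists (E : set (set X)) : countable E -> E `<=` S ->
  exists2 O, topological_realization Gam p act S O &
    forall V B, open V -> E B -> O (vaught V B).
Proof.
move=> cE ES.
have [U [Up Uo Ub]] := quasi_polish_basis G_qp.
have [CG CGP] := basis_complete Up.
(* [f C] is a base, inside [S], of a quasi-Polish topology containing [C]; the constant family is a
   default value. *)
have /choice[f fP] C : exists B : seq nat -> set X, countable C -> C `<=` S ->
    [/\ presented_basis B, forall s, S (B s) & forall V, C V -> family_open B V].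
  have [[cC CS]|nC] := pselect (countable C /\ C `<=` S); last first.
    by exists (fun=> setT) => cC CS; case: nC.
  have [O [Oqp CO OS]] := S_compat cC CS.
  have [B [Bp BO Bb]] := quasi_polish_basis Oqp.
  exists B => _ _; split => // [s|V CV]; first exact/OS/BO.
  exact/Bb/CO.
pose C0 := E `|` range (fun v => p @^-1` (src @` U v)).
pose C1 (B : seq nat -> set X) :=
  range B `|` range (fun ws : seq nat * seq nat => vaught (U ws.1) (B ws.2)).
(* Each level contains the previous base and all its transforms by basic sets, so the union of the
   levels is closed under these transforms. *)
pose B := fix B m := if m is n.+1 then f (C1 (B n)) else f C0.
have cC0 : countable C0.
  by apply: countable_setU => //; exact: countable_image_countType.
have C0S : C0 `<=` S.
  by move=> _ [/ES//|[v _ <-]]; apply: S_anchor; apply: G_open.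
have cC1 D : countable (C1 D).
  by apply: countable_setU; exact: countable_image_countType.
have C1S D : (forall s, S (D s)) -> C1 D `<=` S.
  move=> SD _ [[s _ <-]//|[[w s] _ <-]].
  by apply: S_vaught; apply: vaught_unions_vaught.
have BP m : presented_basis (B m) /\ forall s, S (B m s).
  elim: m => [|m [_ IH]] /=; first by have [] := fP C0 cC0 C0S.
  by have [] := fP _ (cC1 (B m)) (C1S _ IH).
have Bp m := (BP m).1; have BS m := (BP m).2.
have Bstep m V : C1 (B m) V -> family_open (B m.+1) V.
  by have [_ _] := fP _ (cC1 (B m)) (C1S _ (BS m)); exact.
have B0 V : C0 V -> family_open (B 0%N) V by have [_ _] := fP C0 cC0 C0S; exact.
have Binc m s : family_open (B m.+1) (B m s) by apply: Bstep; left; exists s.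
pose A (i : nat * seq nat) := B i.1 i.2.
have BA m V : family_open (B m) V -> family_open A V.
  by move=> oV x /oV[s Bs sV]; exists (m, s).
have [CX CXP] := increasing_cover_complete Bp Binc.
have A_total x : exists a, A a x by exists (0%N, [::]); rewrite /A (basis_nil (Bp _)).
have A_meet a b : family_open A (A a `&` A b).
  case: a b => [m s] [n t]; apply: (BA (maxn m n)) => x [/= Bs Bt].
  have [s' Bs' ss'] := increasing_family_open Binc (leq_maxl m n) Bs.
  have [t' Bt' tt'] := increasing_family_open Binc (leq_maxr m n) Bt.
  exists (s' ++ t'); rewrite (basis_cat (Bp _)) // => y [By By'].
  by split; [exact: ss'|exact: tt'].
have A_separates : family_separates A.
  by move=> x y xy; apply: (basis_separates (Bp 0%N)) => s; exact: (xy (0%N, s)).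
have A_anchor v : family_open A (p @^-1` (src @` U v)).
  by apply: (BA 0%N); apply: B0; right; exists v.
have A_vaught w b : family_open A (vaught (U w) (A b)).
  by case: b => m s; apply: (BA m.+1); apply: Bstep; right; exists (w, s).
have AS a : S (A a) by exact: BS.
have A_borel a : BX (A a) by exact: S_borel.
have openE D : family_open (vaught_base Gam U p act A) D ->
    generated_topology (vaught_base Gam U p act A) D.
  by apply: family_open_mono => i; exact: generated_topology_base.
exists (generated_topology (vaught_base Gam U p act A)); last first.
  move=> V D oV ED; have oD : family_open A D by apply: (BA 0%N); apply: B0; left.
  exact: (openE _ (vaught_base_open Ub X_gspace oV oD)).
split.
- exact: (vaught_topology_quasi_polish G_open Up Uo Ub X_gspace CXP _ _ _ _ _ _ CGP).
- apply: generated_topology_sigma => // i.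
  by apply: S_vaught; apply: vaught_unions_vaught.
- move=> V oV.
  exact: (openE _ (anchor_vaught_base_open G_open Up Uo Ub X_gspace A_total oV)).
- exact: (vaught_topology_act_continuous Uo Ub X_gspace).
Qed.

(** Countably many countable unions involve only countably many second arguments of transforms; [f]
    picks them out, and they are handed to [realization_exists] at once. *)
Lemma vaught_unions_realization (C : set (set X)) :
  countable C -> C `<=` vaught_unions Gam p act S ->
  exists2 O, topological_realization Gam p act S O & C `<=` O.
Proof.
move=> cC CV.
have /choice[F FP] A : exists F, C A -> [/\ countable F,
    F `<=` [set vaught U A | U in @open G & A in S] & A = \bigcup_(B in F) B].
  have [CA|nCA] := pselect (C A); last by exists set0.
  by have [F FP] := CV A CA; exists F.
have /choice[f fP] D : exists B, forall A, C A -> F A D ->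
    S B /\ exists2 V, open V & D = vaught V B.
  have [[A [CA FD]]|no] := pselect (exists A, C A /\ F A D).
    have [_ FS _] := FP A CA; have [V oV [B SB <-]] := FS D FD.
    by exists B => _ _ _; split => //; exists V.
  by exists setT => A CA FD; case: no; exists A.
have [||O OR OV] := @realization_exists (f @` \bigcup_(A in C) F A).
- apply: sub_countable (card_image_le _ _) _.
  by apply: bigcup_countable => // A /FP[].
- by move=> _ [D [A CA FD] <-]; have [] := fP D A CA FD.
exists O => // A CA; have [_ _ AE] := FP A CA; rewrite AE.
have [[_ [d [dq _ dO]]] _ _ _] := OR.
apply: (induced_open_bigcup dO) => D FD.
have [SB [V oV DE]] := fP D A CA FD; rewrite DE.
by apply: OV => //; exists D => //; exists A.
Qed.

(** Acting by the inverse as well, [act g a] is in [A] iff [a] is, so the preimage is the single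
    fiber product of [setT] and [A]. *)
Lemma invariant_fiber_tensor A : S A -> invariant_set Gam p act A ->
  fiber_tensor Gam p (@open G) S (act_preimage Gam p act A).
Proof.
move=> SA Ainv; exists [set fiber_prod Gam p setT A]; split.
- exact: countable1.
- by move=> _ ->; exists setT; [exact: openT|exists A].
- rewrite bigcup_set1; apply/seteqP; split => -[g a].
    move=> [[_ _ /= ga] /= Aga]; split => //=; rewrite -(act_inv X_gspace ga).
    by apply: Ainv => //; rewrite gsrc_inv (gspace_anchor_act X_gspace).
  by move=> [_ /= Aa ga]; split; [split|exact: Ainv].
Qed.

End Realization.

(** * The equivalences *)

Theorem theorem4p3p2 (G0 G : topologicalType) (Gam : topGroupoid G0 G)
    (G_qp : quasi_polish_groupoid Gam) (G_open : open_groupoid Gam)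
    (X : Type) (BX : set (set X)) (p : X -> G0) (act : G -> X -> X)
    (X_gspace : borel_gspace Gam p act BX)
    (S : set (set X)) (S_borel : S `<=` BX)
    (S_sigma : sigma_topology S) (S_compat : compatible S)
    (S_anchor : forall U : set G0, open U -> S (p @^-1` U))
    (S_vaught : vaught_unions Gam p act S `<=` S) :
  let cond_i (A : set X) :=
    exists2 O, topological_realization Gam p act S O & O A in
  let cond_ii (A : set X) := vaught_unions Gam p act S A in
  let cond_iii (A : set X) :=
    fiber_tensor Gam p (@open G) S (act_preimage Gam p act A) in
  let cond_iv (A : set X) :=
    fiber_tensor Gam p (@open G) (vaught_unions Gam p act S)
      (act_preimage Gam p act A) in
  [/\ forall A : set X, BX A ->
        [/\ cond_i A <-> cond_ii A, cond_ii A <-> cond_iii A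
          & cond_iii A <-> cond_iv A],
      forall A : set X, S A -> invariant_set Gam p act A ->
        [/\ cond_i A, cond_ii A, cond_iii A & cond_iv A]
    & forall C : set (set X), countable C -> C `<=` BX ->
        (forall A, C A -> cond_i A) ->
        exists2 O, topological_realization Gam p act S O & C `<=` O].
Proof.
move=> cond_i cond_ii cond_iii cond_iv.
(* The implications run (i) to (iii) to (ii) to (iv) to (iii), and (ii) to (i) is the one-set case
   of the simultaneous statement. *)
have i_iii A : cond_i A -> cond_iii A.
  by move=> [O OR OA]; exact: (realization_fiber_tensor G_qp OR).
have iii_ii A : cond_iii A -> cond_ii A.
  exact: (fiber_tensor_vaught_unions G_qp G_open X_gspace).
have ii_iv A : cond_ii A -> cond_iv A.
  exact: (vaught_unions_fiber_tensor G_qp X_gspace).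
have iv_iii A : cond_iv A -> cond_iii A.
  move=> [C [cC CS CE]]; exists C; split => // D /CS[V oV [B SB <-]].
  by exists V => //; exists B => //; exact: S_vaught.
have simultaneous C : countable C -> (forall A, C A -> cond_ii A) ->
    exists2 O, topological_realization Gam p act S O & C `<=` O.
  move=> cC CV.
  exact: (vaught_unions_realization G_qp G_open X_gspace S_borel S_sigma
    S_compat S_anchor S_vaught cC CV).
have ii_i A : cond_ii A -> cond_i A.
  move=> iiA; have [|A' ->//|O OR AO] := simultaneous [set A].
    exact: countable1.
  by exists O => //; exact: AO.
split.
- by move=> A _; split; split; auto.
- move=> A SA Ainv; have iiiA : cond_iii A.
    exact: (invariant_fiber_tensor X_gspace).
  by split; auto.
- by move=> C cC _ Ci; apply: simultaneous => // A /Ci/i_iii/iii_ii.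
Qed.
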